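(* Let $f$ be holomorphic on the open unit disk $\Delta=\{z\in\mathbb C:|z|<1\}$, let $0<r<1$ and $K=\overline\Delta_r=\{z:|z|\le r\}$. For $n\ge 0$ let $N_K(n)$ denote the maximal number (possibly $+\infty$) of zeros on $K$ of functions $f-p$ with $p\in\mathcal P_n$. If $\lim_{n\to\infty}N_K(n)/n=\infty$, then $f$ is a polynomial.
   Context: $\mathcal P_n$ denotes the space of complex polynomials in one variable of degree at most $n$. Zeros are counted with multiplicity. *)

(* Defs.v *)
From Stdlib Require Import Reals List Arith.
From Coquelicot Require Import Coquelicot.
Open Scope R_scope.

Definition unit_disk (z : C) : Prop := Cmod z < 1.
Definition closed_disk (r : R) (z : C) : Prop := Cmod z <= r.

Definition C_is_derive (f : C -> C) (z l : C) : Prop :=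
  @is_derive C_AbsRing C_NormedModule f z l.

Definition holomorphic_on (U : C -> Prop) (f : C -> C) : Prop :=
  forall z, U z -> exists l, C_is_derive f z l.

Inductive is_nderiv (U : C -> Prop) : nat -> (C -> C) -> (C -> C) -> Prop :=
| nderiv_O f : is_nderiv U O f f
| nderiv_S k f g h : is_nderiv U k f g ->
    (forall z, U z -> C_is_derive g z (h z)) -> is_nderiv U (S k) f h.

(* a is a zero of g of multiplicity at least m (g holomorphic on open U):
   the derivatives of order 0, ..., m-1 vanish at a *)
Definition zero_order_ge (U : C -> Prop) (g : C -> C) (a : C) (m : nat) : Prop :=
  forall k d, (k < m)%nat -> is_nderiv U k g d -> d a = 0%C.

Definition has_zeros_ge (U K : C -> Prop) (g : C -> C) (N : nat) : Prop :=
  exists l : list (C * nat),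
    NoDup (map fst l) /\
    (forall am, In am l -> K (fst am) /\ zero_order_ge U g (fst am) (snd am)) /\
    (N <= fold_right Nat.add 0%nat (map snd l))%nat.

Definition Cpoly_eval (a : list C) (z : C) : C :=
  fold_right (fun c acc => Cplus c (Cmult z acc)) 0%C a.

Definition in_Pn (n : nat) (p : C -> C) : Prop :=
  exists a : list C, (length a <= S n)%nat /\ forall z, p z = Cpoly_eval a z.

Definition NK (f : C -> C) (r : R) (n : nat) : Rbar :=
  Lub_Rbar (fun x => exists p N, in_Pn n p /\
     has_zeros_ge unit_disk (closed_disk r) (fun z => Cminus (f z) (p z)) N /\
     x = INR N).

(* Main.v *)
Require Import Defs.
From Stdlib Require Import Reals List Arith Lra Lia FunctionalExtensionality Classical.
From Coquelicot Require Import Coquelicot.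
Open Scope R_scope.

(** Write [f = sum c_k z^k] and [S_t(g) = sum |g_k|^2 t^(2k)].  If [g = f - p] with
    [deg p <= n] has [N] zeros in [|z| <= r], then replacing each factor [z - a] by
    [R - conj a z / R] preserves [S_R], and at radius [r] each replacement gains a factor
    [kappa = (2rR / (R^2 + r^2))^2 < 1]; hence [S_r(g) <= kappa^N S_R(g)].  Moreover
    [S_R(g) <= (R/r)^(2n) S_r(g) + T] with [T = sum_(k>n) |c_k|^2 R^(2k)], so that
    [|c_k|^2 r^(2k) <= 2 kappa^N T] for [k > n] as soon as [kappa^N (R/r)^(2n) <= 1/2].

    With a fixed [R < 1] and [N/n] large, this makes [c_k (32r)^k] bounded.  If infinitely
    many [c_k] were nonzero, one could then choose [n] large such that
    [|c_k| (16r)^k <= |c_(n+1)| (16r)^(n+1)] for all [k > n]; with [R = 8r] and [N >= 8n]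
    the estimate becomes absurd.

    The Taylor expansion of [f] comes from Goursat's argument on the cone
    [a + s (rho e^(it) - a)], which contracts the circle [|z| = rho] to the point [a]
    without crossing [a]. *)

(** The factor [kappa r R] tends to 1 as [R] tends to [r] and is small only when [R / r] is large.
    As [r] may be close to 1, the unit disk offers no large ratio; this is why the estimate is used
    twice. The first use pays for a poor [kappa] with a large slope [m] in [N >= m n], available
    because [N_K(n) / n] is unbounded along every tail, and buys a large radius for the
    coefficients. With that radius the slope 8 suffices. Halving the radius twice explains 32, 16
    and 8. From 32 to 16 the numbers [|c_k| (16r)^k] tend to 0, so their maximum over a tail of
    indices is attained; from 16 to 8 the tail [T] is dominated by a geometric series led by that
    maximum. The quadratic sums [S_t] suit the problem because both kinds of linear factor act
    explicitly on coefficients, and because subtracting [p] leaves every coefficient of index above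
    [n] untouched. *)

(** * Elementary facts about the modulus *)

Lemma Cmod_le_abs (z : C) : Cmod z <= Rabs (Re z) + Rabs (Im z).
Proof.
  destruct z as [x y]; unfold Cmod; simpl.
  apply Rsqr_incr_0_var.
  - rewrite Rsqr_sqrt by nra. unfold Rsqr.
    assert (Hx := Rabs_pos x). assert (Hy := Rabs_pos y).
    assert (Hx2 : Rabs x * Rabs x = x * x) by (rewrite <- Rabs_mult; apply Rabs_pos_eq; nra).
    assert (Hy2 : Rabs y * Rabs y = y * y) by (rewrite <- Rabs_mult; apply Rabs_pos_eq; nra).
    nra.
  - assert (Hx := Rabs_pos x). assert (Hy := Rabs_pos y). lra.
Qed.

Lemma Rle_div_intro (a b c : R) : 0 < c -> a * c <= b -> a <= b / c.
Proof. intros Hc H. now apply (Rle_div_r a b c). Qed.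

Lemma im_le_Cmod (z : C) : Rabs (Im z) <= Cmod z.
Proof.
  eapply Rle_trans; [|apply Rmax_Cmod]. apply Rmax_r.
Qed.

Lemma Cmod_minus_sym (z w : C) : Cmod (z - w) = Cmod (w - z).
Proof. rewrite <- Cmod_opp. f_equal. ring. Qed.

Lemma Cmod_triangle_minus (z w : C) : Cmod (z - w) <= Cmod z + Cmod w.
Proof.
  unfold Cminus. eapply Rle_trans; [apply Cmod_triangle|]. rewrite Cmod_opp. lra.
Qed.

Lemma Cmult_integral (z w : C) : (z * w)%C = 0%C -> z = 0%C \/ w = 0%C.
Proof.
  intros H. assert (E : Cmod z * Cmod w = 0) by now rewrite <- Cmod_mult, H, Cmod_0.
  apply Rmult_integral in E. destruct E; [left | right]; now apply Cmod_eq_0.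
Qed.

(** * Power series over C *)

Definition CSer (a : nat -> C) : C :=
  (Series (fun k => Re (a k)), Series (fun k => Im (a k))).

Definition cabs (a : nat -> C) : Prop := ex_series (fun k => Cmod (a k)).

Lemma cabs_re a : cabs a -> ex_series (fun k => Re (a k)).
Proof.
  intros H. apply (@ex_series_le R_AbsRing R_CompleteNormedModule) with (2 := H).
  intros n. apply re_le_Cmod.
Qed.

Lemma cabs_im a : cabs a -> ex_series (fun k => Im (a k)).
Proof.
  intros H. apply (@ex_series_le R_AbsRing R_CompleteNormedModule) with (2 := H).
  intros n. apply im_le_Cmod.
Qed.

Lemma CSer_ext a b : (forall k, a k = b k) -> CSer a = CSer b.
Proof.
  intros H. unfold CSer. f_equal; apply Series_ext; intros n; now rewrite H.
Qed.

Lemma CSer_plus a b : cabs a -> cabs b ->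
  CSer (fun k => a k + b k)%C = (CSer a + CSer b)%C.
Proof.
  intros Ha Hb. unfold CSer. apply injective_projections; simpl.
  - apply Series_plus; now apply cabs_re.
  - apply Series_plus; now apply cabs_im.
Qed.

Lemma ex_series_Rscal (c : R) (a : nat -> R) :
  ex_series a -> ex_series (fun n => c * a n).
Proof. exact (@ex_series_scal R_AbsRing R_NormedModule c a). Qed.

Lemma CSer_scal c a : cabs a -> CSer (fun k => c * a k)%C = (c * CSer a)%C.
Proof.
  intros H. unfold CSer. apply injective_projections; simpl.
  - rewrite <- 2!Series_scal_l, <- Series_minus; auto.
    + apply ex_series_Rscal. now apply cabs_re.
    + apply ex_series_Rscal. now apply cabs_im.
  - rewrite <- 2!Series_scal_l, <- Series_plus; auto.
    + apply ex_series_Rscal. now apply cabs_im.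
    + apply ex_series_Rscal. now apply cabs_re.
Qed.

Lemma CSer_incr_1 a : cabs a -> CSer a = (a 0%nat + CSer (fun k => a (S k)))%C.
Proof.
  intros H. unfold CSer. apply injective_projections; simpl.
  - apply Series_incr_1. now apply cabs_re.
  - apply Series_incr_1. now apply cabs_im.
Qed.

(** Real and imaginary parts are bounded separately, hence the factor 2. It is harmless: such bounds
    serve only for boundedness, continuity and geometric decay. *)
Lemma CSer_le a b : (forall k, Cmod (a k) <= b k) -> ex_series b ->
  Cmod (CSer a) <= 2 * Series b.
Proof.
  intros H Hb.
  eapply Rle_trans; [apply Cmod_le_abs|]. simpl.
  assert (Hr : ex_series (fun n => Rabs (Re (a n)))).
  { apply (@ex_series_le R_AbsRing R_CompleteNormedModule) with (2 := Hb).
    intros n. unfold norm; simpl. unfold abs; simpl. rewrite Rabs_Rabsolu.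
    eapply Rle_trans; [apply re_le_Cmod | apply H]. }
  assert (Hi : ex_series (fun n => Rabs (Im (a n)))).
  { apply (@ex_series_le R_AbsRing R_CompleteNormedModule) with (2 := Hb).
    intros n. unfold norm; simpl. unfold abs; simpl. rewrite Rabs_Rabsolu.
    eapply Rle_trans; [apply im_le_Cmod | apply H]. }
  assert (H1 := Series_Rabs _ Hr). assert (H2 := Series_Rabs _ Hi).
  assert (H3 : Series (fun n => Rabs (Re (a n))) <= Series b).
  { apply Series_le; auto. intros n; split; [apply Rabs_pos|].
    eapply Rle_trans; [apply re_le_Cmod | apply H]. }
  assert (H4 : Series (fun n => Rabs (Im (a n))) <= Series b).
  { apply Series_le; auto. intros n; split; [apply Rabs_pos|].
    eapply Rle_trans; [apply im_le_Cmod | apply H]. }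
  lra.
Qed.

Definition bnd_by (R M : R) (c : nat -> C) : Prop :=
  forall k, Cmod (c k) * R ^ k <= M.

(** Cauchy's estimate used as a substitute for a radius of convergence at least [R]: it gives
    absolute convergence for [|z| < R] and passes easily through sums, shifts and products with
    linear factors. *)
Definition bnd (R : R) (c : nat -> C) : Prop := exists M, bnd_by R M c.

Definition ev (c : nat -> C) (z : C) : C := CSer (fun k => c k * z ^ k)%C.

Lemma bnd_term_le R M c z k : 0 < R -> bnd_by R M c ->
  Cmod (c k * z ^ k) <= M * (Cmod z / R) ^ k.
Proof.
  intros HR Hc. rewrite Cmod_mult, Cmod_pow.
  unfold Rdiv. rewrite Rpow_mult_distr, pow_inv.
  assert (0 < R ^ k) by now apply pow_lt.
  assert (0 <= Cmod z ^ k) by (apply pow_le, Cmod_ge_0).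
  replace (Cmod (c k) * Cmod z ^ k) with ((Cmod (c k) * R ^ k) * (Cmod z ^ k * / R ^ k))
    by (field; lra).
  apply Rmult_le_compat_r; [|apply Hc].
  apply Rmult_le_pos; auto. left. now apply Rinv_0_lt_compat.
Qed.

Lemma ratio_lt_1 R t : 0 <= t -> t < R -> 0 <= t / R < 1.
Proof.
  intros H1 H2. split.
  - apply Rdiv_le_0_compat; lra.
  - apply Rlt_div_l; lra.
Qed.

Lemma ex_series_geom_scal M q : 0 <= q < 1 -> ex_series (fun k => M * q ^ k).
Proof.
  intros H. apply ex_series_Rscal. apply ex_series_geom. rewrite Rabs_pos_eq; lra.
Qed.

Lemma Series_geom_scal M q : 0 <= q < 1 -> Series (fun k => M * q ^ k) = M / (1 - q).
Proof.
  intros H. rewrite Series_scal_l, Series_geom; [reflexivity|]. rewrite Rabs_pos_eq; lra.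
Qed.

Lemma bnd_cabs R c z : bnd R c -> Cmod z < R -> cabs (fun k => c k * z ^ k)%C.
Proof.
  intros [M HM] Hz.
  assert (H0 := Cmod_ge_0 z).
  unfold cabs.
  apply (@ex_series_le R_AbsRing R_CompleteNormedModule)
    with (b := fun k => M * (Cmod z / R) ^ k).
  - intros n. unfold norm; simpl; unfold abs; simpl.
    rewrite Rabs_pos_eq by apply Cmod_ge_0. apply bnd_term_le; auto; lra.
  - apply ex_series_geom_scal, ratio_lt_1; auto.
Qed.

Lemma ev_le R M c z t : bnd_by R M c -> Cmod z <= t -> t < R ->
  Cmod (ev c z) <= 2 * (M / (1 - t / R)).
Proof.
  intros HM Hz Ht.
  assert (H0 := Cmod_ge_0 z).
  assert (Hq : 0 <= t / R < 1) by (apply ratio_lt_1; lra).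
  rewrite <- Series_geom_scal by auto.
  apply CSer_le.
  - intros k. eapply Rle_trans; [apply bnd_term_le; eauto; lra|].
    apply Rmult_le_compat_l.
    + specialize (HM 0%nat). simpl in HM. assert (H := Cmod_ge_0 (c 0%nat)). lra.
    + apply pow_incr. split.
      * apply Rdiv_le_0_compat; lra.
      * apply Rmult_le_compat_r; auto. left. apply Rinv_0_lt_compat. lra.
  - now apply ex_series_geom_scal.
Qed.

Lemma ev_ext c d z : (forall k, c k = d k) -> ev c z = ev d z.
Proof. intros H. apply CSer_ext. intros k. now rewrite H. Qed.

Lemma ev_plus R c d z : bnd R c -> bnd R d -> Cmod z < R ->
  ev (fun k => c k + d k)%C z = (ev c z + ev d z)%C.
Proof.
  intros Hc Hd Hz. unfold ev. rewrite <- CSer_plus; eauto using bnd_cabs.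
  apply CSer_ext. intros k. ring.
Qed.

Lemma ev_scal R l c z : bnd R c -> Cmod z < R ->
  ev (fun k => l * c k)%C z = (l * ev c z)%C.
Proof.
  intros Hc Hz. unfold ev. rewrite <- CSer_scal; eauto using bnd_cabs.
  apply CSer_ext. intros k. ring.
Qed.

Lemma bnd_by_shift R M c m : 0 < R -> bnd_by R M c ->
  bnd_by R (M / R ^ m) (fun k => c (m + k)%nat).
Proof.
  intros HR H k. apply Rle_div_intro; [now apply pow_lt|].
  rewrite Rmult_assoc, <- pow_add, (Nat.add_comm k m). apply H.
Qed.

Lemma bnd_shift R c m : 0 < R -> bnd R c -> bnd R (fun k => c (m + k)%nat).
Proof. intros HR [M HM]. exists (M / R ^ m). now apply bnd_by_shift. Qed.

Lemma bnd_plus R c d : bnd R c -> bnd R d -> 0 < R -> bnd R (fun k => c k + d k)%C.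
Proof.
  intros [M HM] [M' HM'] HR. exists (M + M'). intros k.
  assert (H := HM k). assert (H' := HM' k).
  assert (0 < R ^ k) by now apply pow_lt.
  assert (H2 := Cmod_triangle (c k) (d k)). nra.
Qed.

Lemma bnd_scal R l c : bnd R c -> bnd R (fun k => l * c k)%C.
Proof.
  intros [M HM]. exists (Cmod l * M). intros k.
  rewrite Cmod_mult, Rmult_assoc. apply Rmult_le_compat_l; [apply Cmod_ge_0 | apply HM].
Qed.

Lemma bnd_le R R' c : 0 < R' -> R' <= R -> bnd R c -> bnd R' c.
Proof.
  intros HR' H [M HM]. exists M. intros k.
  eapply Rle_trans; [|apply HM]. apply Rmult_le_compat_l; [apply Cmod_ge_0|].
  apply pow_incr; lra.
Qed.

Lemma bnd_ext R c d : (forall k, c k = d k) -> bnd R c -> bnd R d.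
Proof. intros H [M HM]. exists M. intros k. rewrite <- H. apply HM. Qed.

Lemma ev_incr_1 R c z : bnd R c -> Cmod z < R ->
  ev c z = (c 0%nat + z * ev (fun k => c (S k)) z)%C.
Proof.
  intros Hc Hz. assert (H0 := Cmod_ge_0 z). unfold ev.
  rewrite CSer_incr_1 by eauto using bnd_cabs.
  rewrite <- CSer_scal.
  - f_equal. + simpl. ring. + apply CSer_ext. intros k. simpl. ring.
  - apply bnd_cabs with R; auto. apply (bnd_shift R c 1); auto. lra.
Qed.

Lemma ev_0 R c : 0 < R -> bnd R c -> ev c 0 = c 0%nat.
Proof.
  intros HR Hc. rewrite (ev_incr_1 R); auto; [ring|]. now rewrite Cmod_0.
Qed.

(* Coefficients of [(z - a) h(z)]. *)
Definition mulX (a : C) (h : nat -> C) (k : nat) : C :=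
  match k with
  | O => (- a * h O)%C
  | S j => (h j - a * h (S j))%C
  end.

Lemma bnd_mulX R a h : 0 < R -> bnd R h -> bnd R (mulX a h).
Proof.
  intros HR [M HM]. exists (R * M + Cmod a * M). intros [|k].
  - simpl. rewrite Cmod_mult, Cmod_opp. assert (H := HM 0%nat). simpl in H.
    assert (H1 := Cmod_ge_0 a). assert (H2 := Cmod_ge_0 (h 0%nat)). nra.
  - cbn [mulX]. assert (H := HM k). assert (H' := HM (S k)).
    assert (Hp : 0 < R ^ S k) by now apply pow_lt.
    assert (H3 := Cmod_triangle_minus (h k) (a * h (S k))).
    rewrite Cmod_mult in H3. assert (H1 := Cmod_ge_0 a).
    apply Rle_trans with ((Cmod (h k) + Cmod a * Cmod (h (S k))) * R ^ S k).
    { apply Rmult_le_compat_r; lra. }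
    rewrite Rmult_plus_distr_r. apply Rplus_le_compat.
    + simpl. replace (Cmod (h k) * (R * R ^ k)) with (R * (Cmod (h k) * R ^ k)) by ring.
      apply Rmult_le_compat_l; lra.
    + rewrite Rmult_assoc. now apply Rmult_le_compat_l.
Qed.

Lemma ev_mulX R a h z : bnd R h -> Cmod z < R -> ev (mulX a h) z = ((z - a) * ev h z)%C.
Proof.
  intros Hh Hz. assert (H0 := Cmod_ge_0 z).
  assert (HR : 0 < R) by lra.
  rewrite (ev_incr_1 R); auto using bnd_mulX.
  rewrite (ev_ext _ (fun k => h k + (- a) * h (S k))%C).
  2: intros k; cbn [mulX]; ring.
  assert (Hs : bnd R (fun k => h (S k))) by now apply (bnd_shift R h 1).
  rewrite (ev_plus R), (ev_scal R); auto using bnd_scal.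
  cbn [mulX].
  replace (-a * h 0%nat + z * (ev h z + -a * ev (fun k => h (S k)) z))%C
    with (z * ev h z - a * (h 0%nat + z * ev (fun k => h (S k)) z))%C by ring.
  rewrite <- (ev_incr_1 R h z); auto. ring.
Qed.

(** Synthetic division: the coefficients of [(ev c z - ev c a) / (z - a)], obtained from [(z^n -
    a^n) / (z - a) = sum_(k<n) z^k a^(n-1-k)]. *)
Definition quotX (a : C) (c : nat -> C) (k : nat) : C := ev (fun j => c (S k + j)%nat) a.

(** The shift by [k + 1] is bounded by [M / R^(k+1)], and [a] lies strictly inside the disk. No
    radius is lost, so the division can be repeated any number of times. *)
Lemma bnd_quotX R a c : bnd R c -> Cmod a < R -> bnd R (quotX a c).
Proof.
  intros [M HM] Ha. assert (H0 := Cmod_ge_0 a). assert (HR : 0 < R) by lra.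
  exists (2 * (M / R / (1 - Cmod a / R))). intros k.
  assert (Hq : 0 <= Cmod a / R < 1) by (apply ratio_lt_1; lra).
  assert (HP : 0 < R ^ k) by now apply pow_lt.
  apply Rle_div_r; auto.
  eapply Rle_trans.
  - apply ev_le with (R := R) (t := Cmod a) (M := M / R ^ S k); auto; [|lra].
    now apply bnd_by_shift.
  - right. simpl. field. repeat split; try lra.
Qed.

(** Division with remainder at the level of coefficients; it rests on the recursion
    [q_k = c_(k+1) + a q_(k+1)]. *)
Lemma quotX_spec R a c : bnd R c -> Cmod a < R ->
  forall k, c k = (match k with O => ev c a | S _ => 0 end + mulX a (quotX a c) k)%C.
Proof.
  intros Hc Ha. assert (H0 := Cmod_ge_0 a). assert (HR : 0 < R) by lra.
  assert (E : forall k, quotX a c k = (c (S k) + a * quotX a c (S k))%C).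
  { intros k. unfold quotX at 1. rewrite (ev_incr_1 R); auto using bnd_shift.
    rewrite Nat.add_0_r. f_equal. f_equal. apply ev_ext. intros j. f_equal. lia. }
  intros [|k].
  - cbn [mulX]. rewrite (ev_incr_1 R c a); auto. unfold quotX. simpl. ring.
  - cbn [mulX]. rewrite (E k). ring.
Qed.

Lemma ev_quotX R a c z : bnd R c -> Cmod a < R -> Cmod z < R ->
  ev c z = (ev c a + (z - a) * ev (quotX a c) z)%C.
Proof.
  intros Hc Ha Hz. assert (H0 := Cmod_ge_0 a). assert (HR : 0 < R) by lra.
  assert (Hq := bnd_quotX R a c Hc Ha).
  rewrite <- (ev_mulX R); auto.
  assert (Hd : bnd R (fun k : nat => match k with O => ev c a | S _ => 0 end)%C).
  { exists (Cmod (ev c a)). intros [|k]; simpl; [lra|]. rewrite Cmod_0.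
    assert (H := Cmod_ge_0 (ev c a)). lra. }
  rewrite (ev_ext c _ z (quotX_spec R a c Hc Ha)).
  rewrite (ev_plus R); auto using bnd_mulX.
  f_equal. rewrite (ev_incr_1 R); auto.
  replace (ev (fun _ : nat => 0%C) z) with (ev (fun _ : nat => 0 * 0)%C z).
  - rewrite (ev_scal R (0%C) (fun _ => 0%C)); auto; [ring|].
    exists 0. intros k. rewrite Cmod_0. lra.
  - apply ev_ext. intros. ring.
Qed.

(** * Complex differentiability *)

Definition cdiff (f : C -> C) (z l : C) : Prop :=
  forall eps, 0 < eps -> exists delta, 0 < delta /\
    forall w, Cmod (w - z) < delta ->
      Cmod (f w - f z - l * (w - z)) <= eps * Cmod (w - z).

Lemma C_is_derive_cdiff f z l : C_is_derive f z l <-> cdiff f z l.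
Proof.
  split.
  - intros [_ H] eps He.
    destruct (H z (fun P HP => HP) (mkposreal _ He)) as [d Hd].
    exists d. split; [apply cond_pos|]. intros w Hw.
    specialize (Hd w Hw). simpl in Hd.
    replace (f w - f z - l * (w - z))%C
      with (minus (minus (f w) (f z)) (scal (minus w z) l)); [exact Hd|].
    unfold minus, plus, opp, scal; simpl. unfold mult; simpl. ring.
  - intros H. split.
    + apply is_linear_scal_l.
    + intros x Hx eps.
      assert (E : z = x).
      { apply (is_filter_lim_locally_unique (K := C_AbsRing) (V := AbsRing_NormedModule C_AbsRing)).
        exact Hx. }
      rewrite <- E.
      destruct (H eps (cond_pos eps)) as [d [Hd0 Hd]].
      exists (mkposreal _ Hd0). intros w Hw.
      specialize (Hd w Hw).
      eapply Rle_trans; [right | exact Hd].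
      change (Cmod ((f w + - f z) + - ((w + - z) * l)) = Cmod (f w - f z - l * (w - z)))%C.
      f_equal. unfold minus, plus, opp, scal; simpl. unfold mult; simpl. ring.
Qed.

Lemma ev_lipschitz R c z t : bnd R c -> Cmod z < R -> t < R ->
  exists L, 0 < L /\ forall w, Cmod w <= t -> Cmod (ev c w - ev c z) <= L * Cmod (w - z).
Proof.
  intros Hc Hz Ht. destruct (bnd_quotX R z c Hc Hz) as [M HM].
  exists (Rmax 1 (2 * (M / (1 - t / R)))). split.
  { eapply Rlt_le_trans; [|apply Rmax_l]. lra. }
  intros w Hw. rewrite (ev_quotX R z c w) by (auto; lra).
  replace (ev c z + (w - z) * ev (quotX z c) w - ev c z)%C
    with ((w - z) * ev (quotX z c) w)%C by ring.
  rewrite Cmod_mult, Rmult_comm. apply Rmult_le_compat_r; [apply Cmod_ge_0|].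
  eapply Rle_trans; [|apply Rmax_r]. now apply ev_le.
Qed.

(** The difference quotient of [ev c] at [z] is exactly [ev (quotX z c)], and this function is
    Lipschitz near [z]. *)
Lemma cdiff_ev_quotX R c z : bnd R c -> Cmod z < R -> cdiff (ev c) z (ev (quotX z c) z).
Proof.
  intros Hc Hz eps He.
  assert (H0 := Cmod_ge_0 z).
  set (t := (Cmod z + R) / 2).
  destruct (ev_lipschitz R (quotX z c) z t) as [L [HL H]]; auto using bnd_quotX.
  { unfold t; lra. }
  exists (Rmin (t - Cmod z) (eps / L)). split.
  { apply Rmin_pos; [unfold t; lra|]. now apply Rdiv_lt_0_compat. }
  intros w Hw.
  assert (Hw1 : Cmod (w - z) < t - Cmod z) by (eapply Rlt_le_trans; [exact Hw | apply Rmin_l]).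
  assert (Hw2 : Cmod (w - z) < eps / L) by (eapply Rlt_le_trans; [exact Hw | apply Rmin_r]).
  assert (Hwt : Cmod w <= t).
  { replace w with ((w - z) + z)%C by ring. assert (H1 := Cmod_triangle (w - z) z). lra. }
  rewrite (ev_quotX R z c w); auto. 2: unfold t in *; lra.
  replace (ev c z + (w - z) * ev (quotX z c) w - ev c z - ev (quotX z c) z * (w - z))%C
    with ((ev (quotX z c) w - ev (quotX z c) z) * (w - z))%C by ring.
  rewrite Cmod_mult. apply Rmult_le_compat_r; [apply Cmod_ge_0|].
  eapply Rle_trans; [now apply H|].
  apply Rlt_div_r in Hw2; auto. lra.
Qed.

(** * Termwise differentiation and uniqueness of coefficients *)

Definition dseq (c : nat -> C) (k : nat) : C := (INR (S k) * c (S k))%C.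

(** As [q^j] decreases in [j], [k q^k] is at most [1 + q + ... + q^k], hence at most
    [1 / (1 - q)]. *)
Lemma nat_geom_bounded q : 0 <= q < 1 -> exists M, forall k, INR k * q ^ k <= M.
Proof.
  intros Hq. exists (/ (1 - q)).
  intros k. assert (H : INR k * q ^ k <= sum_f_R0 (fun j => q ^ j) k).
  { induction k.
    - simpl. lra.
    - rewrite S_INR, tech5.
      assert (q ^ S k <= q ^ k).
      { simpl. assert (0 <= q ^ k) by (apply pow_le; lra). nra. }
      assert (INR k * q ^ S k <= INR k * q ^ k) by (apply Rmult_le_compat_l; auto; apply pos_INR).
      lra. }
  eapply Rle_trans; [apply H|]. rewrite tech3 by lra.
  unfold Rdiv. assert (0 <= q ^ S k) by (apply pow_le; lra).
  assert (0 < / (1 - q)) by (apply Rinv_0_lt_compat; lra). nra.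
Qed.

(** The factor [k + 1] is absorbed by passing to a smaller radius, so every differentiation costs an
    arbitrarily small part of [R]. *)
Lemma bnd_dseq R R' c : 0 < R' -> R' < R -> bnd R c -> bnd R' (dseq c).
Proof.
  intros H1 H2 [M HM]. assert (Hq : 0 <= R' / R < 1) by (apply ratio_lt_1; lra).
  destruct (nat_geom_bounded _ Hq) as [B HB].
  assert (HM0 : 0 <= M).
  { specialize (HM 0%nat). simpl in HM. assert (H := Cmod_ge_0 (c 0%nat)). lra. }
  exists (M * B / R'). intros k. unfold dseq.
  rewrite Cmod_mult, Cmod_R, Rabs_pos_eq by apply pos_INR.
  apply Rle_div_intro; auto.
  specialize (HB (S k)). specialize (HM (S k)).
  assert (HP : 0 < R ^ S k) by (apply pow_lt; lra).
  replace (INR (S k) * Cmod (c (S k)) * R' ^ k * R')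
    with ((Cmod (c (S k)) * R ^ S k) * (INR (S k) * (R' / R) ^ S k)).
  - apply Rmult_le_compat; auto.
    + apply Rmult_le_pos; [apply Cmod_ge_0 | lra].
    + apply Rmult_le_pos; [apply pos_INR | apply pow_le; lra].
  - unfold Rdiv. rewrite Rpow_mult_distr, pow_inv.
    change (R' ^ S k) with (R' * R' ^ k). field. lra.
Qed.

Lemma dseq_mulX a h k : dseq (mulX a h) k = (h k + mulX a (dseq h) k)%C.
Proof.
  unfold dseq. destruct k as [|k]; cbn [mulX].
  - simpl. apply injective_projections; simpl; ring.
  - rewrite (S_INR (S k)), RtoC_plus. ring.
Qed.

(** Leibniz' rule on coefficients replaces an interchange of limit and sum: up to a constant, [c] is
    [(w - z) q(w)] with [q = quotX z c], whose formal derivative [q + (w - z) q'] takes the value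
    [q(z)] at [w = z], the derivative already found. *)
Lemma cdiff_ev R c z : bnd R c -> Cmod z < R -> cdiff (ev c) z (ev (dseq c) z).
Proof.
  intros Hc Hz.
  assert (H0 := Cmod_ge_0 z).
  set (t := (Cmod z + R) / 2).
  assert (Ht1 : Cmod z < t) by (unfold t; lra). assert (Ht2 : t < R) by (unfold t; lra).
  replace (ev (dseq c) z) with (ev (quotX z c) z); [now apply cdiff_ev_quotX with R|].
  assert (Hq := bnd_quotX R z c Hc Hz).
  rewrite (ev_ext (dseq c) (fun k => quotX z c k + mulX z (dseq (quotX z c)) k)%C).
  - assert (Hd : bnd t (dseq (quotX z c))) by (apply bnd_dseq with R; auto; lra).
    rewrite (ev_plus t), (ev_mulX t); auto.
    + ring.
    + apply bnd_le with R; auto; lra.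
    + apply bnd_mulX; auto; lra.
  - intros k. rewrite <- dseq_mulX. unfold dseq. f_equal.
    rewrite (quotX_spec R z c Hc Hz (S k)). ring.
Qed.

Lemma cdiff_unique f z l l' : cdiff f z l -> cdiff f z l' -> l = l'.
Proof.
  intros H H'.
  assert (E : Cmod (l - l') = 0).
  { destruct (Req_dec (Cmod (l - l')) 0) as [e|n]; auto.
    exfalso. assert (HP := Cmod_ge_0 (l - l')).
    assert (He : 0 < Cmod (l - l') / 4) by lra.
    destruct (H _ He) as [d [Hd Hd1]]. destruct (H' _ He) as [d' [Hd' Hd1']].
    set (e := Rmin d d' / 2).
    assert (He2 : 0 < e) by (assert (Hmin := Rmin_pos _ _ Hd Hd'); unfold e; lra).
    assert (Hm : Cmod (z + e - z) = e).
    { replace (z + e - z)%C with (RtoC e) by ring. rewrite Cmod_R, Rabs_pos_eq; lra. }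
    specialize (Hd1 (z + e)%C). specialize (Hd1' (z + e)%C). rewrite Hm in *.
    assert (X := Rmin_l d d'). assert (Y := Rmin_r d d').
    specialize (Hd1 ltac:(unfold e in *; lra)). specialize (Hd1' ltac:(unfold e in *; lra)).
    assert (T := Cmod_triangle_minus (f (z + e) - f z - l' * (z + e - z))%C
      (f (z + e) - f z - l * (z + e - z))%C).
    replace (f (z + e) - f z - l' * (z + e - z) - (f (z + e) - f z - l * (z + e - z)))%C
      with ((l - l') * e)%C in T by ring.
    rewrite Cmod_mult, Cmod_R, Rabs_pos_eq in T by lra. nra. }
  apply Cmod_eq_0 in E. replace l with (l' + (l - l'))%C by ring. rewrite E. ring.
Qed.

Lemma cdiff_ext f g z l rho : 0 < rho -> (forall w, Cmod (w - z) < rho -> f w = g w) ->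
  cdiff f z l -> cdiff g z l.
Proof.
  intros Hr Heq H eps He. destruct (H eps He) as [d [Hd H1]].
  exists (Rmin d rho). split; [now apply Rmin_pos|]. intros w Hw.
  rewrite <- !Heq.
  - apply H1. eapply Rlt_le_trans; [exact Hw | apply Rmin_l].
  - replace (z - z)%C with (RtoC 0) by ring. now rewrite Cmod_0.
  - eapply Rlt_le_trans; [exact Hw | apply Rmin_r].
Qed.

(** Equality at 0 gives the constant terms; the induction then removes them and divides by [z]. At
    [z = 0], where division is impossible, the values of the divided series agree as derivatives of
    the same function. *)
Lemma ev_unique R c d : 0 < R -> bnd R c -> bnd R d ->
  (forall z, Cmod z < R -> ev c z = ev d z) -> forall k, c k = d k.
Proof.
  intros HR Hc Hd H k. revert c d Hc Hd H.
  induction k; intros c d Hc Hd H.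
  - rewrite <- (ev_0 R c), <- (ev_0 R d); auto. apply H. now rewrite Cmod_0.
  - assert (E0 : c 0%nat = d 0%nat).
    { rewrite <- (ev_0 R c), <- (ev_0 R d); auto. apply H. now rewrite Cmod_0. }
    assert (Hc' : bnd R (fun k => c (S k))) by now apply (bnd_shift R c 1).
    assert (Hd' : bnd R (fun k => d (S k))) by now apply (bnd_shift R d 1).
    apply (IHk (fun k => c (S k)) (fun k => d (S k))); auto.
    intros z Hz.
    destruct (Req_dec (Cmod z) 0) as [e|n].
    + apply Cmod_eq_0 in e. subst z.
      assert (D1 := cdiff_ev_quotX R c 0%C Hc Hz).
      assert (D2 := cdiff_ev_quotX R d 0%C Hd Hz).
      assert (D3 : cdiff (ev c) 0%C (ev (quotX 0 d) 0%C)).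
      { apply (cdiff_ext (ev d)) with R; auto. intros w Hw. symmetry. apply H.
        now replace w with (w - 0)%C by ring. }
      assert (E := cdiff_unique _ _ _ _ D1 D3).
      rewrite (ev_0 R) in E by auto using bnd_quotX.
      rewrite (ev_0 R (quotX 0 d)) in E by auto using bnd_quotX.
      exact E.
    + assert (E := H z Hz).
      rewrite (ev_incr_1 R c), (ev_incr_1 R d), E0 in E; auto.
      assert (E2 : (z * (ev (fun k => c (S k)) z - ev (fun k => d (S k)) z) = 0)%C).
      { replace (z * (ev (fun k0 : nat => c (S k0)) z - ev (fun k0 : nat => d (S k0)) z))%C
         with ((d 0%nat + z * ev (fun k : nat => c (S k)) z) - (d 0%nat + z * ev (fun k : nat => d (S k)) z))%C by ring.
        rewrite E. ring. }
      apply Cmult_integral in E2. destruct E2 as [E2|E2]; [exfalso; apply n; rewrite E2; apply Cmod_0|].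
      replace (ev (fun k0 : nat => c (S k0)) z) with
        ((ev (fun k0 : nat => c (S k0)) z - ev (fun k0 : nat => d (S k0)) z) + ev (fun k0 : nat => d (S k0)) z)%C by ring.
      rewrite E2. ring.
Qed.

(** * Integrals of complex-valued functions of a real variable *)

Definition CInt (u : R -> C) (a b : R) : C :=
  (RInt (fun t => Re (u t)) a b, RInt (fun t => Im (u t)) a b).

Definition ccont (u : R -> C) (t : R) : Prop :=
  continuous (fun x => Re (u x)) t /\ continuous (fun x => Im (u x)) t.

Definition cder (u : R -> C) (t : R) (d : C) : Prop :=
  is_derive (fun x => Re (u x)) t (Re d) /\ is_derive (fun x => Im (u x)) t (Im d).

Lemma continuous_eps (g : R -> R) t :
  (forall eps, 0 < eps -> exists delta, 0 < delta /\
     forall y, Rabs (y - t) < delta -> Rabs (g y - g t) < eps) <-> continuous g t.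
Proof.
  split.
  - intros H. apply filterlim_locally. intros eps.
    destruct (H eps (cond_pos eps)) as [d [Hd H1]].
    exists (mkposreal d Hd). intros y Hy. apply H1. exact Hy.
  - intros H eps He. destruct (proj1 (filterlim_locally _ _) H (mkposreal eps He)) as [d Hd].
    exists d. split; [apply cond_pos|]. intros y Hy. now apply Hd.
Qed.

Lemma cder_ccont u t d : cder u t d -> ccont u t.
Proof.
  intros [H1 H2]. split.
  - apply (ex_derive_continuous (fun x => Re (u x))). now exists (Re d).
  - apply (ex_derive_continuous (fun x => Im (u x))). now exists (Im d).
Qed.

Lemma ccont_const z t : ccont (fun _ => z) t.
Proof. split; apply continuous_const. Qed.

Lemma ccont_plus u v t : ccont u t -> ccont v t -> ccont (fun x => u x + v x)%C t.
Proof.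
  intros [H1 H2] [H3 H4]. split.
  - apply (continuous_plus (V := R_NormedModule) (fun x => Re (u x)) (fun x => Re (v x))); auto.
  - apply (continuous_plus (V := R_NormedModule) (fun x => Im (u x)) (fun x => Im (v x))); auto.
Qed.

Lemma ccont_opp u t : ccont u t -> ccont (fun x => - u x)%C t.
Proof.
  intros [H1 H2]. split.
  - apply (continuous_opp (V := R_NormedModule) (fun x => Re (u x))); auto.
  - apply (continuous_opp (V := R_NormedModule) (fun x => Im (u x))); auto.
Qed.

Lemma ccont_minus u v t : ccont u t -> ccont v t -> ccont (fun x => u x - v x)%C t.
Proof. intros H1 H2. apply ccont_plus; auto using ccont_opp. Qed.

Lemma ccont_mult u v t : ccont u t -> ccont v t -> ccont (fun x => u x * v x)%C t.
Proof.
  intros [H1 H2] [H3 H4]. split.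
  - apply (continuous_minus (V := R_NormedModule)
      (fun x => Re (u x) * Re (v x)) (fun x => Im (u x) * Im (v x)));
    apply (continuous_mult (K := R_AbsRing)); auto.
  - apply (continuous_plus (V := R_NormedModule)
      (fun x => Re (u x) * Im (v x)) (fun x => Im (u x) * Re (v x)));
    apply (continuous_mult (K := R_AbsRing)); auto.
Qed.

Lemma ccont_pow u n t : ccont u t -> ccont (fun x => u x ^ n)%C t.
Proof.
  intros H. induction n; simpl.
  - apply ccont_const.
  - now apply ccont_mult.
Qed.

Lemma ccont_eps u t : ccont u t -> forall eps, 0 < eps -> exists delta, 0 < delta /\
  forall y, Rabs (y - t) < delta -> Cmod (u y - u t) < eps.
Proof.
  intros [H1 H2] eps He.
  destruct (proj2 (continuous_eps _ _) H1 (eps / 2) ltac:(lra)) as [d1 [Hd1 K1]].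
  destruct (proj2 (continuous_eps _ _) H2 (eps / 2) ltac:(lra)) as [d2 [Hd2 K2]].
  exists (Rmin d1 d2). split; [now apply Rmin_pos|]. intros y Hy.
  assert (A := Rmin_l d1 d2). assert (B := Rmin_r d1 d2).
  specialize (K1 y ltac:(lra)). specialize (K2 y ltac:(lra)).
  eapply Rle_lt_trans; [apply Cmod_le_abs|]. simpl. unfold Re, Im, Rminus in *. lra.
Qed.

Lemma ccont_of_eps u t : (forall eps, 0 < eps -> exists delta, 0 < delta /\
  forall y, Rabs (y - t) < delta -> Cmod (u y - u t) < eps) -> ccont u t.
Proof.
  intros H. split; apply continuous_eps; intros eps He; destruct (H eps He) as [d [Hd K]];
  exists d; split; auto; intros y Hy; specialize (K y Hy);
  (eapply Rle_lt_trans; [|exact K]).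
  - apply (re_le_Cmod (u y - u t)).
  - apply (im_le_Cmod (u y - u t)).
Qed.

Lemma cdiff_lipschitz F z l : cdiff F z l -> exists delta, 0 < delta /\
  forall w, Cmod (w - z) < delta -> Cmod (F w - F z) <= (Cmod l + 1) * Cmod (w - z).
Proof.
  intros H. destruct (H 1 ltac:(lra)) as [d [Hd K]]. exists d. split; auto.
  intros w Hw. specialize (K w Hw).
  replace (F w - F z)%C with ((F w - F z - l * (w - z)) + l * (w - z))%C by ring.
  eapply Rle_trans; [apply Cmod_triangle|]. rewrite (Cmod_mult l). lra.
Qed.

(** Differentiability of [F] at [u t] gives a Lipschitz bound there, which is all the continuity
    that is needed. *)
Lemma ccont_comp F u t l : cdiff F (u t) l -> ccont u t -> ccont (fun x => F (u x)) t.
Proof.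
  intros HF Hu. apply ccont_of_eps. intros eps He.
  destruct (cdiff_lipschitz _ _ _ HF) as [d [Hd K]].
  assert (Hl := Cmod_ge_0 l).
  assert (He' : 0 < eps / (Cmod l + 1)) by (apply Rdiv_lt_0_compat; lra).
  destruct (ccont_eps _ _ Hu (Rmin d (eps / (Cmod l + 1)))) as [d' [Hd' K']].
  { now apply Rmin_pos. }
  exists d'. split; auto. intros y Hy. specialize (K' y Hy).
  assert (A := Rmin_l d (eps / (Cmod l + 1))). assert (B := Rmin_r d (eps / (Cmod l + 1))).
  eapply Rle_lt_trans; [apply K; lra|].
  assert (Q : Cmod (u y - u t) < eps / (Cmod l + 1)) by lra.
  apply Rlt_div_r in Q; lra.
Qed.

Lemma ccont_inv u t : ccont u t -> u t <> 0%C -> ccont (fun x => / u x)%C t.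
Proof.
  intros [H1 H2] Hn.
  assert (Hp : Re (u t) ^ 2 + Im (u t) ^ 2 <> 0).
  { rewrite <- Cmod2_alt. apply pow_nonzero. intros E. now apply Hn, Cmod_eq_0. }
  assert (Hc : continuous (fun x => / (Re (u x) ^ 2 + Im (u x) ^ 2)) t).
  { apply continuous_comp with (g := Rinv).
    - apply (continuous_plus (V := R_NormedModule) (fun x => Re (u x) ^ 2) (fun x => Im (u x) ^ 2)); simpl;
      repeat apply (continuous_mult (K := R_AbsRing)); auto; apply continuous_const.
    - now apply continuous_Rinv. }
  split.
  - apply (continuous_mult (K := R_AbsRing) (fun x => Re (u x)) (fun x => / (Re (u x) ^ 2 + Im (u x) ^ 2))); auto.
  - apply (continuous_mult (K := R_AbsRing) (fun x => - Im (u x)) (fun x => / (Re (u x) ^ 2 + Im (u x) ^ 2))); auto.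
    apply (continuous_opp (V := R_NormedModule) (fun x => Im (u x))); auto.
Qed.

Definition ccont_on (u : R -> C) (a b : R) : Prop := forall t, a <= t <= b -> ccont u t.

Lemma ccont_on_ex u a b : a <= b -> ccont_on u a b ->
  ex_RInt (fun t => Re (u t)) a b /\ ex_RInt (fun t => Im (u t)) a b.
Proof.
  intros Hab H. split; apply (ex_RInt_continuous (V := R_CompleteNormedModule));
  rewrite Rmin_left, Rmax_right by auto; intros t Ht; now apply H.
Qed.

Lemma CInt_ext u v a b : a <= b -> (forall t, a <= t <= b -> u t = v t) ->
  CInt u a b = CInt v a b.
Proof.
  intros Hab H. unfold CInt. f_equal; apply RInt_ext; rewrite Rmin_left, Rmax_right by auto;
  intros t Ht; rewrite H; auto; lra.
Qed.

Lemma CInt_Chasles u a b c : a <= b -> b <= c -> ccont_on u a c ->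
  CInt u a c = (CInt u a b + CInt u b c)%C.
Proof.
  intros H1 H2 H.
  assert (Hab : ccont_on u a b) by (intros t Ht; apply H; lra).
  assert (Hbc : ccont_on u b c) by (intros t Ht; apply H; lra).
  apply ccont_on_ex in Hab; auto. apply ccont_on_ex in Hbc; auto.
  unfold CInt. apply injective_projections; simpl; symmetry;
  [apply (RInt_Chasles (V := R_CompleteNormedModule) (fun t => Re (u t)))
  |apply (RInt_Chasles (V := R_CompleteNormedModule) (fun t => Im (u t)))]; tauto.
Qed.

Lemma CInt_plus u v a b : a <= b -> ccont_on u a b -> ccont_on v a b ->
  CInt (fun t => u t + v t)%C a b = (CInt u a b + CInt v a b)%C.
Proof.
  intros Hab Hu Hv. apply ccont_on_ex in Hu; auto. apply ccont_on_ex in Hv; auto.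
  unfold CInt. apply injective_projections; simpl;
  [apply (RInt_plus (V := R_CompleteNormedModule) (fun t => Re (u t)) (fun t => Re (v t)))
  |apply (RInt_plus (V := R_CompleteNormedModule) (fun t => Im (u t)) (fun t => Im (v t)))]; tauto.
Qed.

Lemma CInt_scal l u a b : a <= b -> ccont_on u a b ->
  CInt (fun t => l * u t)%C a b = (l * CInt u a b)%C.
Proof.
  intros Hab Hu. apply ccont_on_ex in Hu; auto. destruct Hu as [H1 H2].
  assert (S1 : forall k, is_RInt (fun t => k * Re (u t)) a b (k * RInt (fun t => Re (u t)) a b)).
  { intros k. apply (is_RInt_scal (V := R_NormedModule)).
    now apply (RInt_correct (V := R_CompleteNormedModule)). }
  assert (S2 : forall k, is_RInt (fun t => k * Im (u t)) a b (k * RInt (fun t => Im (u t)) a b)).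
  { intros k. apply (is_RInt_scal (V := R_NormedModule)).
    now apply (RInt_correct (V := R_CompleteNormedModule)). }
  unfold CInt. apply injective_projections; simpl; apply is_RInt_unique.
  - apply (is_RInt_minus (V := R_NormedModule) (fun t => fst l * Re (u t)) (fun t => snd l * Im (u t))); auto.
  - apply (is_RInt_plus (V := R_NormedModule) (fun t => fst l * Im (u t)) (fun t => snd l * Re (u t))); auto.
Qed.

Lemma CInt_le u a b M : a <= b -> ccont_on u a b -> (forall t, a <= t <= b -> Cmod (u t) <= M) ->
  Cmod (CInt u a b) <= 2 * ((b - a) * M).
Proof.
  intros Hab Hu HM. apply ccont_on_ex in Hu; auto. destruct Hu as [H1 H2].
  eapply Rle_trans; [apply Cmod_le_abs|]. unfold CInt; simpl.
  assert (A : Rabs (RInt (fun t => Re (u t)) a b) <= (b - a) * M).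
  { apply (norm_RInt_le_const (V := R_NormedModule) (fun t => Re (u t)) a b); auto.
    - intros t Ht. eapply Rle_trans; [apply re_le_Cmod | now apply HM].
    - now apply (RInt_correct (V := R_CompleteNormedModule)). }
  assert (B : Rabs (RInt (fun t => Im (u t)) a b) <= (b - a) * M).
  { apply (norm_RInt_le_const (V := R_NormedModule) (fun t => Im (u t)) a b); auto.
    - intros t Ht. eapply Rle_trans; [apply im_le_Cmod | now apply HM].
    - now apply (RInt_correct (V := R_CompleteNormedModule)). }
  lra.
Qed.

Lemma CInt_derive U u a b : a <= b -> (forall t, a <= t <= b -> cder U t (u t)) ->
  ccont_on u a b -> CInt u a b = (U b - U a)%C.
Proof.
  intros Hab HU Hu. unfold CInt. apply injective_projections; simpl; apply is_RInt_unique.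
  - apply (is_RInt_derive (V := R_CompleteNormedModule) (fun t => Re (U t)));
    rewrite Rmin_left, Rmax_right by auto; intros t Ht; [apply HU | apply Hu]; auto.
  - apply (is_RInt_derive (V := R_CompleteNormedModule) (fun t => Im (U t)));
    rewrite Rmin_left, Rmax_right by auto; intros t Ht; [apply HU | apply Hu]; auto.
Qed.

Lemma ccont_on_bounded u a b : a <= b -> ccont_on u a b ->
  exists M, forall t, a <= t <= b -> Cmod (u t) <= M.
Proof.
  intros Hab Hu.
  destruct (continuity_ab_maj (fun t => Rabs (Re (u t)) + Rabs (Im (u t))) a b Hab) as [x [Hx _]].
  - intros t Ht. apply continuity_pt_filterlim.
    destruct (Hu t Ht) as [H1 H2].
    apply (continuous_plus (V := R_NormedModule) (fun t => Rabs (Re (u t))) (fun t => Rabs (Im (u t)))).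
    + apply continuous_comp with (g := Rabs); auto. apply continuous_Rabs.
    + apply continuous_comp with (g := Rabs); auto. apply continuous_Rabs.
  - exists (Rabs (Re (u x)) + Rabs (Im (u x))). intros t Ht.
    eapply Rle_trans; [apply Cmod_le_abs|]. now apply Hx.
Qed.

(** The single case of the complex chain rule that Goursat's argument requires: an affine integrand
    has a quadratic antiderivative. *)
Lemma cder_quadratic u t d al be : cder u t d ->
  cder (fun x => al * u x + be * (u x * u x))%C t ((al + 2 * be * u t) * d)%C.
Proof.
  intros [H1 H2].
  set (p := fun x => Re (u x)) in *. set (q := fun x => Im (u x)) in *.
  assert (Ep : ex_derive p t) by now exists (Re d).
  assert (Eq : ex_derive q t) by now exists (Im d).
  split.
  - apply (is_derive_ext (fun x => (Re al * p x - Im al * q x)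
      + (Re be * (p x * p x - q x * q x) - Im be * (p x * q x + q x * p x)))).
    { reflexivity. }
    auto_derive; [tauto|].
    replace (Derive (fun x => p x) t) with (Re d) by (symmetry; now apply is_derive_unique).
    replace (Derive (fun x => q x) t) with (Im d) by (symmetry; now apply is_derive_unique).
    unfold p, q. simpl. unfold Re, Im. ring.
  - apply (is_derive_ext (fun x => (Re al * q x + Im al * p x)
      + (Re be * (p x * q x + q x * p x) + Im be * (p x * p x - q x * q x)))).
    { reflexivity. }
    auto_derive; [tauto|].
    replace (Derive (fun x => p x) t) with (Re d) by (symmetry; now apply is_derive_unique).
    replace (Derive (fun x => q x) t) with (Im d) by (symmetry; now apply is_derive_unique).
    unfold p, q. simpl. unfold Re, Im. ring.
Qed.

(** * Goursat's theorem on a cone over a circle *)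

Definition cis (t : R) : C := (cos t, sin t).

Lemma Cmod_cis t : Cmod (cis t) = 1.
Proof.
  unfold Cmod, cis; simpl.
  replace (cos t * (cos t * 1) + sin t * (sin t * 1)) with (Rsqr (sin t) + Rsqr (cos t)) by (unfold Rsqr; ring).
  rewrite sin2_cos2. apply sqrt_1.
Qed.

Lemma cder_cis t : cder cis t (Ci * cis t)%C.
Proof.
  split; simpl.
  - apply (is_derive_ext cos); [reflexivity|]. auto_derive; auto. ring.
  - apply (is_derive_ext sin); [reflexivity|]. auto_derive; auto. ring.
Qed.

Lemma ccont_cis t : ccont cis t.
Proof. eapply cder_ccont, cder_cis. Qed.

Lemma Rabs_diff_le_of_derive (g dg : R -> R) x y :
  (forall t, is_derive g t (dg t)) -> (forall t, Rabs (dg t) <= 1) ->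
  Rabs (g y - g x) <= Rabs (y - x).
Proof.
  intros Hg Hd.
  destruct (MVT_gen g x y dg) as [c [_ E]].
  - intros; apply Hg.
  - intros t _. apply continuity_pt_filterlim.
    apply (ex_derive_continuous g). now exists (dg t).
  - rewrite E, Rabs_mult. specialize (Hd c). assert (H := Rabs_pos (y - x)). nra.
Qed.

Lemma Cmod_cis_diff x y : Cmod (cis y - cis x) <= 2 * Rabs (y - x).
Proof.
  eapply Rle_trans; [apply Cmod_le_abs|]. unfold cis; simpl.
  assert (A : Rabs (cos y - cos x) <= Rabs (y - x)).
  { apply Rabs_diff_le_of_derive with (fun t => - sin t).
    - intros t. auto_derive; auto. ring.
    - intros t. rewrite Rabs_Ropp. assert (H := SIN_bound t). apply Rabs_le; lra. }
  assert (B : Rabs (sin y - sin x) <= Rabs (y - x)).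
  { apply Rabs_diff_le_of_derive with cos.
    - intros t. auto_derive; auto. ring.
    - intros t. assert (H := COS_bound t). apply Rabs_le; lra. }
  unfold Rminus in *. lra.
Qed.

(** The vector from [a] to the point of the circle at angle [t]. On the cone [Phi] below, [gam] is
    the derivative in [s] and [s * dgam] the derivative in [t]. *)
Definition gam (rho : R) (a : C) (t : R) : C := (rho * cis t - a)%C.
Definition dgam (rho t : R) : C := (rho * (Ci * cis t))%C.
Definition Phi (rho : R) (a : C) (s t : R) : C := (a + s * gam rho a t)%C.

Lemma cder_Phi_t rho a s t : cder (Phi rho a s) t (s * dgam rho t)%C.
Proof.
  destruct (cder_cis t) as [H1 H2]. unfold Re, Im in *. simpl in *.
  split; unfold Phi, gam, dgam, Re, Im; simpl.
  - auto_derive; auto. ring.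
  - auto_derive; auto. ring.
Qed.

Lemma cder_Phi_s rho a s t : cder (fun s => Phi rho a s t) s (gam rho a t).
Proof.
  split; unfold Phi, gam, Re, Im; simpl.
  - auto_derive; auto. ring.
  - auto_derive; auto. ring.
Qed.

Lemma ccont_dgam rho t : ccont (dgam rho) t.
Proof.
  unfold dgam. apply ccont_mult; [apply ccont_const|].
  apply ccont_mult; [apply ccont_const | apply ccont_cis].
Qed.

Lemma Cmod_dgam rho t : 0 <= rho -> Cmod (dgam rho t) = rho.
Proof.
  intros H. unfold dgam. rewrite !Cmod_mult, Cmod_R, Cmod_Ci, Cmod_cis, Rabs_pos_eq; lra.
Qed.

Lemma Cmod_gam rho a t : 0 <= rho <= 1 -> Cmod a <= 1 -> Cmod (gam rho a t) <= 2.
Proof.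
  intros H1 H2. unfold gam. eapply Rle_trans; [apply Cmod_triangle_minus|].
  rewrite Cmod_mult, Cmod_R, Cmod_cis, Rabs_pos_eq; lra.
Qed.

Lemma Cmod_Phi_diff rho a s t s' t' : 0 <= rho <= 1 -> Cmod a <= 1 -> 0 <= s' <= 1 ->
  Cmod (Phi rho a s t - Phi rho a s' t') <= 2 * (Rabs (s - s') + Rabs (t - t')).
Proof.
  intros Hr Ha Hs.
  replace (Phi rho a s t - Phi rho a s' t')%C
    with ((s - s') * gam rho a t + s' * (rho * (cis t - cis t')))%C by (unfold Phi, gam; ring).
  eapply Rle_trans; [apply Cmod_triangle|].
  rewrite <- RtoC_minus, !Cmod_mult, !Cmod_R.
  assert (A := Cmod_gam rho a t Hr Ha). assert (B := Cmod_cis_diff t' t).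
  assert (P := Rabs_pos (s - s')). assert (P2 := Rabs_pos (t - t')).
  rewrite (Rabs_pos_eq s'), (Rabs_pos_eq rho) by lra.
  assert (E : s' * (rho * Cmod (cis t - cis t')) <= 2 * Rabs (t - t')).
  { assert (H := Cmod_ge_0 (cis t - cis t')).
    apply Rle_trans with (Cmod (cis t - cis t')); [|auto].
    assert (0 <= s' * rho <= 1) by nra. nra. }
  nra.
Qed.

(** [hint] integrates [F dz] along the closed curves of constant [s], or arcs of them; [vint]
    integrates along the segments of constant [t], which point away from [a]. *)
Definition hint (rho : R) (a : C) (F : C -> C) (s t1 t2 : R) : C :=
  CInt (fun t => F (Phi rho a s t) * (s * dgam rho t))%C t1 t2.
Definition vint (rho : R) (a : C) (F : C -> C) (t s1 s2 : R) : C :=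
  CInt (fun s => F (Phi rho a s t) * gam rho a t)%C s1 s2.

(* Boundary integral of [F dz] over the image of [[s1,s2] x [t1,t2]] under [Phi]. *)
Definition bint (rho : R) (a : C) (F : C -> C) (s1 s2 t1 t2 : R) : C :=
  (hint rho a F s2 t1 t2 - hint rho a F s1 t1 t2
   - (vint rho a F t2 s1 s2 - vint rho a F t1 s1 s2))%C.

(** Taking [S1 > 0] keeps the vertex [a] out, so that [F] may be singular there. *)
Definition hol_cone (rho : R) (a : C) (F : C -> C) (S1 S2 : R) : Prop :=
  forall s t, S1 <= s <= S2 -> exists l, cdiff F (Phi rho a s t) l.

Lemma ccont_hint rho a F S1 S2 s t : hol_cone rho a F S1 S2 -> S1 <= s <= S2 ->
  ccont (fun t => F (Phi rho a s t) * (s * dgam rho t))%C t.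
Proof.
  intros HF Hs. destruct (HF s t Hs) as [l Hl].
  apply ccont_mult.
  - apply ccont_comp with l; auto. eapply cder_ccont, cder_Phi_t.
  - apply ccont_mult; [apply ccont_const | apply ccont_dgam].
Qed.

Lemma ccont_vint rho a F S1 S2 s t : hol_cone rho a F S1 S2 -> S1 <= s <= S2 ->
  ccont (fun s => F (Phi rho a s t) * gam rho a t)%C s.
Proof.
  intros HF Hs. destruct (HF s t Hs) as [l Hl].
  apply ccont_mult; [|apply ccont_const].
  apply ccont_comp with (u := fun s => Phi rho a s t) (l := l); auto. eapply cder_ccont, cder_Phi_s.
Qed.

Lemma bint_split rho a F S1 S2 s t d e : hol_cone rho a F S1 S2 ->
  0 <= d -> 0 <= e -> S1 <= s -> s + 2 * d <= S2 ->
  bint rho a F s (s + 2 * d) t (t + 2 * e) =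
  (bint rho a F s (s + d) t (t + e) + bint rho a F (s + d) (s + d + d) t (t + e)
   + bint rho a F s (s + d) (t + e) (t + e + e)
   + bint rho a F (s + d) (s + d + d) (t + e) (t + e + e))%C.
Proof.
  intros HF Hd He H1 H2.
  replace (s + 2 * d) with (s + d + d) in * by ring.
  replace (t + 2 * e) with (t + e + e) by ring.
  unfold bint.
  assert (CH : forall x, S1 <= x <= S2 ->
    hint rho a F x t (t + e + e) = (hint rho a F x t (t + e) + hint rho a F x (t + e) (t + e + e))%C).
  { intros x Hx. apply CInt_Chasles; try lra. intros y Hy. now apply ccont_hint with S1 S2. }
  assert (CV : forall y,
    vint rho a F y s (s + d + d) = (vint rho a F y s (s + d) + vint rho a F y (s + d) (s + d + d))%C).
  { intros y. apply CInt_Chasles; try lra. intros x Hx. apply ccont_vint with S1 S2; auto; lra. }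
  rewrite !CH, !CV by lra. ring.
Qed.

Lemma hol_cone_affine rho a S1 S2 al be : hol_cone rho a (fun z => al + be * z)%C S1 S2.
Proof.
  intros s t _. exists be. intros eps He. exists 1. split; [lra|]. intros w _.
  replace (al + be * w - (al + be * Phi rho a s t) - be * (w - Phi rho a s t))%C with (RtoC 0) by ring.
  rewrite Cmod_0. assert (H := Cmod_ge_0 (w - Phi rho a s t)). nra.
Qed.

(** With an antiderivative [P], each side contributes a difference of values of [P] at two corners,
    and the four differences cancel. *)
Lemma bint_affine rho a al be s1 s2 t1 t2 : s1 <= s2 -> t1 <= t2 ->
  bint rho a (fun z => al + be * z)%C s1 s2 t1 t2 = 0%C.
Proof.
  intros Hs Ht.
  set (P := fun z => (al * z + (be / 2) * (z * z))%C).
  assert (E2 : (2 * (be / 2) = be)%C).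
  { field. }
  assert (HH : forall s, hint rho a (fun z => al + be * z)%C s t1 t2
     = (P (Phi rho a s t2) - P (Phi rho a s t1))%C).
  { intros s. apply CInt_derive with (U := fun t => P (Phi rho a s t)); auto.
    - intros t _. unfold P. cbv beta.
      replace (al + be * Phi rho a s t)%C with (al + 2 * (be / 2) * Phi rho a s t)%C by now rewrite E2.
      apply (cder_quadratic (Phi rho a s)). apply cder_Phi_t.
    - intros t _. apply (ccont_hint rho a (fun z => al + be * z)%C s s); [apply hol_cone_affine | lra]. }
  assert (VV : forall t, vint rho a (fun z => al + be * z)%C t s1 s2
     = (P (Phi rho a s2 t) - P (Phi rho a s1 t))%C).
  { intros t. apply CInt_derive with (U := fun s => P (Phi rho a s t)); auto.
    - intros s _. unfold P. cbv beta.
      replace (al + be * Phi rho a s t)%C with (al + 2 * (be / 2) * Phi rho a s t)%C by now rewrite E2.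
      apply (cder_quadratic (fun s => Phi rho a s t)). apply cder_Phi_s.
    - intros s _. apply (ccont_vint rho a (fun z => al + be * z)%C s s); [apply hol_cone_affine | lra]. }
  unfold bint. rewrite !HH, !VV. ring.
Qed.

Lemma hol_cone_minus_affine rho a F S1 S2 al be : hol_cone rho a F S1 S2 ->
  hol_cone rho a (fun z => F z - (al + be * z))%C S1 S2.
Proof.
  intros HF s t Hs. destruct (HF s t Hs) as [l Hl]. exists (l - be)%C.
  intros eps He. destruct (Hl eps He) as [d [Hd K]]. exists d. split; auto.
  intros w Hw. specialize (K w Hw). set (z := Phi rho a s t) in *.
  replace (F w - (al + be * w) - (F z - (al + be * z)) - (l - be) * (w - z))%C
    with (F w - F z - l * (w - z))%C by ring. exact K.
Qed.

(** Permits replacing [F] by its first-order remainder at the point where the nested rectangles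
    shrink. *)
Lemma bint_minus_affine rho a F S1 S2 al be s1 s2 t1 t2 : hol_cone rho a F S1 S2 ->
  S1 <= s1 -> s1 <= s2 -> s2 <= S2 -> t1 <= t2 ->
  bint rho a (fun z => F z - (al + be * z))%C s1 s2 t1 t2 = bint rho a F s1 s2 t1 t2.
Proof.
  intros HF H1 H2 H3 Ht.
  assert (HG := hol_cone_minus_affine rho a F S1 S2 al be HF).
  assert (HL := hol_cone_affine rho a S1 S2 al be).
  set (G := fun z => (F z - (al + be * z))%C) in *.
  set (L := fun z => (al + be * z)%C) in *.
  assert (HH : forall s, S1 <= s <= S2 -> hint rho a F s t1 t2
     = (hint rho a G s t1 t2 + hint rho a L s t1 t2)%C).
  { intros s Hs. unfold hint. rewrite <- CInt_plus; auto.
    - apply CInt_ext; auto. intros t _. unfold G, L. ring.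
    - intros t _. now apply ccont_hint with S1 S2.
    - intros t _. now apply ccont_hint with S1 S2. }
  assert (VV : forall t, vint rho a F t s1 s2
     = (vint rho a G t s1 s2 + vint rho a L t s1 s2)%C).
  { intros t. unfold vint. rewrite <- CInt_plus; auto.
    - apply CInt_ext; auto. intros s _. unfold G, L. ring.
    - intros s Hs. apply ccont_vint with S1 S2; auto; lra.
    - intros s Hs. apply ccont_vint with S1 S2; auto; lra. }
  assert (E0 := bint_affine rho a al be s1 s2 t1 t2 H2 Ht). fold L in E0.
  replace (bint rho a F s1 s2 t1 t2)
    with (bint rho a G s1 s2 t1 t2 + bint rho a L s1 s2 t1 t2)%C.
  - rewrite E0. ring.
  - unfold bint. rewrite !HH, !VV by lra. ring.
Qed.

(** Each side costs twice its parameter length times the speed, at most 1 in [t] and at most 2 in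
    [s], times [M]. Two opposite sides of each kind give [4] and [8]; the larger covers both. *)
Lemma bint_le rho a F S1 S2 s1 s2 t1 t2 M : hol_cone rho a F S1 S2 ->
  0 <= rho <= 1 -> Cmod a <= 1 -> 0 <= S1 -> S2 <= 1 ->
  S1 <= s1 -> s1 <= s2 -> s2 <= S2 -> t1 <= t2 -> 0 <= M ->
  (forall s t, s1 <= s <= s2 -> t1 <= t <= t2 -> Cmod (F (Phi rho a s t)) <= M) ->
  Cmod (bint rho a F s1 s2 t1 t2) <= 8 * M * ((s2 - s1) + (t2 - t1)).
Proof.
  intros HF Hr Ha H0 H1 Hs1 Hs Hs2 Ht HM0 HM.
  assert (HH : forall s, s1 <= s <= s2 -> Cmod (hint rho a F s t1 t2) <= 2 * ((t2 - t1) * M)).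
  { intros s Hss. apply CInt_le; auto.
    - intros t _. apply ccont_hint with S1 S2; auto; lra.
    - intros t Htt. rewrite !Cmod_mult, Cmod_dgam, Cmod_R, Rabs_pos_eq by lra.
      specialize (HM s t Hss Htt). assert (H := Cmod_ge_0 (F (Phi rho a s t))).
      assert (0 <= s * rho <= 1) by nra. nra. }
  assert (VV : forall t, t1 <= t <= t2 -> Cmod (vint rho a F t s1 s2) <= 2 * ((s2 - s1) * (M * 2))).
  { intros t Htt. apply CInt_le; auto.
    - intros s Hss. apply ccont_vint with S1 S2; auto; lra.
    - intros s Hss. rewrite Cmod_mult. apply Rmult_le_compat; try apply Cmod_ge_0; auto.
      now apply Cmod_gam. }
  assert (A := HH s1 ltac:(lra)). assert (B := HH s2 ltac:(lra)).
  assert (C' := VV t1 ltac:(lra)). assert (D := VV t2 ltac:(lra)).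
  unfold bint. eapply Rle_trans; [apply Cmod_triangle_minus|].
  assert (T1 := Cmod_triangle_minus (hint rho a F s2 t1 t2) (hint rho a F s1 t1 t2)).
  assert (T2 := Cmod_triangle_minus (vint rho a F t2 s1 s2) (vint rho a F t1 s1 s2)).
  nra.
Qed.

(** The result is a sigma type, not an existential, so that [corner] can iterate the choice by
    recursion. *)
Lemma largest_quadrant rho a F (s t d e : R) :
  {p : R * R | (fst p = s \/ fst p = s + d) /\ (snd p = t \/ snd p = t + e) /\
   Cmod (bint rho a F s (s + d) t (t + e) + bint rho a F (s + d) (s + d + d) t (t + e)
     + bint rho a F s (s + d) (t + e) (t + e + e)
     + bint rho a F (s + d) (s + d + d) (t + e) (t + e + e))
   <= 4 * Cmod (bint rho a F (fst p) (fst p + d) (snd p) (snd p + e))}.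
Proof.
  set (B1 := bint rho a F s (s + d) t (t + e)).
  set (B2 := bint rho a F (s + d) (s + d + d) t (t + e)).
  set (B3 := bint rho a F s (s + d) (t + e) (t + e + e)).
  set (B4 := bint rho a F (s + d) (s + d + d) (t + e) (t + e + e)).
  assert (T1 := Cmod_triangle (B1 + B2 + B3) B4).
  assert (T2 := Cmod_triangle (B1 + B2) B3).
  assert (T3 := Cmod_triangle B1 B2).
  set (X := Cmod (B1 + B2 + B3 + B4)) in *.
  destruct (Rle_lt_dec X (4 * Cmod B1)); [exists (s, t); simpl; auto|].
  destruct (Rle_lt_dec X (4 * Cmod B2)); [exists (s + d, t); simpl; auto|].
  destruct (Rle_lt_dec X (4 * Cmod B3)); [exists (s, t + e); simpl; auto|].
  exists (s + d, t + e); simpl. fold B4. repeat split; auto. lra.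
Qed.

Fixpoint corner (rho : R) (a : C) (F : C -> C) (s t d e : R) (n : nat) : R * R :=
  match n with
  | O => (s, t)
  | S m => let p := corner rho a F s t d e m in
      proj1_sig (largest_quadrant rho a F (fst p) (snd p) (d / 2 ^ S m) (e / 2 ^ S m))
  end.

(** Left ends increase and right ends decrease, so every left end is below every right end; the
    supremum of the left ends lies in all the intervals. *)
Lemma nested_intervals (u : nat -> R) d : 0 <= d ->
  (forall n, u (S n) = u n \/ u (S n) = u n + d / 2 ^ S n) ->
  exists x, forall n, u n <= x <= u n + d / 2 ^ n.
Proof.
  intros Hd H.
  assert (Hh : forall n, d / 2 ^ n = 2 * (d / 2 ^ S n)).
  { intros n. simpl. field. apply pow_nonzero. lra. }
  assert (Hp : forall n, 0 <= d / 2 ^ n).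
  { intros n. apply Rdiv_le_0_compat; auto. apply pow_lt; lra. }
  assert (H1 : forall n k, u n <= u (n + k)%nat).
  { intros n. induction k.
    - rewrite Nat.add_0_r. lra.
    - rewrite Nat.add_succ_r. specialize (Hp (S (n + k))).
      destruct (H (n + k)%nat) as [E|E]; rewrite E; lra. }
  assert (H2 : forall n k, u (n + k)%nat + d / 2 ^ (n + k) <= u n + d / 2 ^ n).
  { intros n. induction k.
    - rewrite Nat.add_0_r. lra.
    - rewrite Nat.add_succ_r. specialize (Hp (S (n + k))). specialize (Hh (n + k)%nat).
      destruct (H (n + k)%nat) as [E|E]; rewrite E; lra. }
  assert (H3 : forall n m, u m <= u n + d / 2 ^ n).
  { intros n m. destruct (le_lt_dec m n).
    - replace n with (m + (n - m))%nat by lia. specialize (H1 m (n - m)%nat).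
      specialize (Hp (m + (n - m))%nat). lra.
    - replace m with (n + (m - n))%nat by lia. specialize (H2 n (m - n)%nat).
      specialize (Hp (n + (m - n))%nat). lra. }
  destruct (completeness (fun x => exists n, x = u n)) as [x [Hx1 Hx2]].
  - exists (u 0%nat + d / 2 ^ 0). intros y [n ->]. apply H3.
  - exists (u 0%nat). now exists 0%nat.
  - exists x. intros n. split.
    + apply Hx1. now exists n.
    + apply Hx2. intros y [m ->]. apply H3.
Qed.

Lemma nested_in_first (u : nat -> R) d : 0 <= d ->
  (forall n, u (S n) = u n \/ u (S n) = u n + d / 2 ^ S n) ->
  forall n, u 0%nat <= u n /\ u n + d / 2 ^ n <= u 0%nat + d.
Proof.
  intros Hd H n. induction n.
  - simpl. lra.
  - assert (Hh : d / 2 ^ n = 2 * (d / 2 ^ S n)).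
    { simpl. field. apply pow_nonzero. lra. }
    assert (Hp : 0 <= d / 2 ^ S n) by (apply Rdiv_le_0_compat; auto; apply pow_lt; lra).
    destruct (H n) as [E|E]; rewrite E; lra.
Qed.

Lemma goursat rho a F s0 t0 d e : 0 <= rho <= 1 -> Cmod a <= 1 ->
  0 <= s0 -> 0 <= d -> s0 + d <= 1 -> 0 <= e -> hol_cone rho a F s0 (s0 + d) ->
  bint rho a F s0 (s0 + d) t0 (t0 + e) = 0%C.
Proof.
  intros Hr Ha Hs0 Hd Hs1 He HF.
  set (u := fun n => fst (corner rho a F s0 t0 d e n)).
  set (v := fun n => snd (corner rho a F s0 t0 d e n)).
  assert (Hu : forall n, u (S n) = u n \/ u (S n) = u n + d / 2 ^ S n).
  { intros n. unfold u at 1 3. cbn [corner].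
    exact (proj1 (proj2_sig (largest_quadrant rho a F (u n) (v n) (d / 2 ^ S n) (e / 2 ^ S n)))). }
  assert (Hv : forall n, v (S n) = v n \/ v (S n) = v n + e / 2 ^ S n).
  { intros n. unfold v at 1 3. cbn [corner].
    exact (proj1 (proj2 (proj2_sig (largest_quadrant rho a F (u n) (v n) (d / 2 ^ S n) (e / 2 ^ S n))))). }
  assert (Hin := nested_in_first u d Hd Hu). change (u 0%nat) with s0 in Hin.
  set (B := fun n => bint rho a F (u n) (u n + d / 2 ^ n) (v n) (v n + e / 2 ^ n)).
  assert (Hdp : forall n, 0 <= d / 2 ^ n) by (intros n; apply Rdiv_le_0_compat; auto; apply pow_lt; lra).
  assert (Hep : forall n, 0 <= e / 2 ^ n) by (intros n; apply Rdiv_le_0_compat; auto; apply pow_lt; lra).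
  assert (HB : forall n, Cmod (B n) <= 4 * Cmod (B (S n))).
  { intros n.
    assert (Q := proj2 (proj2 (proj2_sig (largest_quadrant rho a F (u n) (v n) (d / 2 ^ S n) (e / 2 ^ S n))))).
    change (proj1_sig (largest_quadrant rho a F (u n) (v n) (d / 2 ^ S n) (e / 2 ^ S n)))
      with (corner rho a F s0 t0 d e (S n)) in Q.
    fold (u (S n)) in Q. fold (v (S n)) in Q.
    assert (E1 : d / 2 ^ n = 2 * (d / 2 ^ S n)) by (simpl; field; apply pow_nonzero; lra).
    assert (E2 : e / 2 ^ n = 2 * (e / 2 ^ S n)) by (simpl; field; apply pow_nonzero; lra).
    destruct (Hin n) as [I1 I2].
    unfold B at 1. rewrite E1, E2, (bint_split rho a F s0 (s0 + d)); auto.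
    rewrite E1 in I2. exact I2. }
  assert (HB4 : forall n, Cmod (B 0%nat) <= 4 ^ n * Cmod (B n)).
  { induction n.
    - simpl. lra.
    - eapply Rle_trans; [apply IHn|]. specialize (HB n).
      assert (0 < 4 ^ n) by (apply pow_lt; lra). simpl. nra. }
  destruct (nested_intervals u d Hd Hu) as [xs Hxs].
  destruct (nested_intervals v e He Hv) as [xt Hxt].
  assert (Hxs0 : s0 <= xs <= s0 + d).
  { specialize (Hxs 0%nat). simpl in Hxs. change (u 0%nat) with s0 in Hxs. lra. }
  destruct (HF xs xt Hxs0) as [l Hl].
  set (z0 := Phi rho a xs xt) in *.
  set (D := d + e).
  assert (HD : 0 <= D) by (unfold D; lra).
  (* With [h = 2^(-n)], the remainder of [F] on the [n]-th rectangle is at most [eps * 2Dh], and the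
     side lengths add up to [Dh]. The factor [4^n] lost in the selection cancels [h^2], which leaves
     a bound independent of [n]. *)
  assert (Key : forall eps, 0 < eps -> Cmod (B 0%nat) <= 16 * D * D * eps).
  { intros eps Heps. destruct (Hl eps Heps) as [delta [Hdelta K]].
    (* Chosen so that [2Dh], the bound on the distance to [z0], is below [delta]; the [+ 1] covers
       the degenerate case [D = 0]. *)
    destruct (pow_lt_1_zero (/ 2)) with (y := delta / (2 * D + 1)) as [n Hn].
    { rewrite Rabs_pos_eq; lra. }
    { apply Rdiv_lt_0_compat; lra. }
    specialize (Hn n (le_n _)). rewrite Rabs_pos_eq in Hn by (apply pow_le; lra).
    apply Rlt_div_r in Hn; [|lra].
    set (h := (/ 2) ^ n) in *.
    assert (Hh0 : 0 < h) by (apply pow_lt; lra).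
    assert (Ed : d / 2 ^ n = d * h) by (unfold h; rewrite pow_inv; reflexivity).
    assert (Ee : e / 2 ^ n = e * h) by (unfold h; rewrite pow_inv; reflexivity).
    assert (Eh : 4 ^ n * (h * h) = 1).
    { unfold h. rewrite <- Rpow_mult_distr, <- Rpow_mult_distr.
      replace (4 * (/ 2 * / 2)) with 1 by field. apply pow1. }
    destruct (Hin n) as [I1 I2]. specialize (Hxs n). specialize (Hxt n).
    specialize (HB4 n). unfold B at 2 in HB4.
    assert (Hdn := Hdp n). assert (Hen := Hep n).
    rewrite <- (bint_minus_affine rho a F s0 (s0 + d) (F z0 - l * z0) l) in HB4; auto; try lra.
    assert (Bd : Cmod (bint rho a (fun z => F z - (F z0 - l * z0 + l * z))%C
        (u n) (u n + d / 2 ^ n) (v n) (v n + e / 2 ^ n))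
      <= 8 * (eps * (2 * (D * h))) * ((u n + d / 2 ^ n - u n) + (v n + e / 2 ^ n - v n))).
    { apply bint_le with s0 (s0 + d); auto; try lra.
      - now apply hol_cone_minus_affine.
      - assert (0 <= D * h) by nra. nra.
      - intros s t Hs Ht.
        assert (Hz : Cmod (Phi rho a s t - z0) <= 2 * (D * h)).
        { eapply Rle_trans; [apply Cmod_Phi_diff; auto; lra|].
          rewrite Ed, Ee in *.
          assert (Rabs (s - xs) <= d * h) by (apply Rabs_le; lra).
          assert (Rabs (t - xt) <= e * h) by (apply Rabs_le; lra).
          unfold D. lra. }
        assert (Hz2 : Cmod (Phi rho a s t - z0) < delta) by nra.
        specialize (K _ Hz2).
        replace (F (Phi rho a s t) - (F z0 - l * z0 + l * Phi rho a s t))%C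
          with (F (Phi rho a s t) - F z0 - l * (Phi rho a s t - z0))%C by ring.
        eapply Rle_trans; [exact K|]. apply Rmult_le_compat_l; lra. }
    rewrite Ed, Ee in *.
    replace (u n + d * h - u n + (v n + e * h - v n)) with (D * h) in Bd by (unfold D; ring).
    assert (P4 : 0 < 4 ^ n) by (apply pow_lt; lra).
    eapply Rle_trans; [exact HB4|].
    eapply Rle_trans; [apply Rmult_le_compat_l; [lra | exact Bd]|].
    right. replace (4 ^ n * (8 * (eps * (2 * (D * h))) * (D * h)))
      with (16 * D * D * eps * (4 ^ n * (h * h))) by ring.
    rewrite Eh. ring. }
  assert (E0 : B 0%nat = bint rho a F s0 (s0 + d) t0 (t0 + e)).
  { unfold B, u, v. simpl. now rewrite !Rdiv_1_r. }
  rewrite <- E0. apply Cmod_eq_0. apply Rle_antisym; [|apply Cmod_ge_0].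
  apply Rnot_lt_le. intros Hlt.
  set (x := Cmod (B 0%nat)) in *.
  assert (HDD : 0 <= D * D) by nra.
  specialize (Key (x / (32 * (D * D) + 1)) ltac:(apply Rdiv_lt_0_compat; lra)).
  assert (Q : 16 * D * D * (x / (32 * (D * D) + 1)) < x).
  { replace (16 * D * D * (x / (32 * (D * D) + 1))) with ((16 * (D * D) * x) / (32 * (D * D) + 1)) by (field; lra).
    apply Rlt_div_l; nra. }
  lra.
Qed.

(** * Cauchy's formula and Taylor expansion *)

Lemma cdiff_minus_const f z l c : cdiff f z l -> cdiff (fun w => f w - c)%C z l.
Proof.
  intros H eps He. destruct (H eps He) as [d [Hd K]]. exists d. split; auto.
  intros w Hw. replace (f w - c - (f z - c) - l * (w - z))%C with (f w - f z - l * (w - z))%C by ring.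
  auto.
Qed.

Lemma cdiff_inv_shift (a z : C) : z <> a -> cdiff (fun w => / (w - a))%C z (- / ((z - a) * (z - a)))%C.
Proof.
  intros Hza eps He.
  assert (Hn : (z - a <> 0)%C).
  { intros E. apply Hza. replace z with (z - a + a)%C by ring. rewrite E. ring. }
  assert (Hp : 0 < Cmod (z - a)) by now apply Cmod_gt_0.
  set (p := Cmod (z - a)) in *.
  (* The first bound keeps [|w - a| >= p / 2]; the error is then at most [2 |w - z|^2 / p^3], which
     the second bound controls. *)
  exists (Rmin (p / 2) (eps * p * p * p / 2)).
  assert (Hq : 0 < eps * p * p * p / 2).
  { assert (0 < p * p) by nra. assert (0 < p * p * p) by nra. nra. }
  split; [apply Rmin_pos; lra|].
  intros w Hw.
  assert (H1 := Rmin_l (p / 2) (eps * p * p * p / 2)).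
  assert (H2 := Rmin_r (p / 2) (eps * p * p * p / 2)).
  assert (Hwa : p / 2 <= Cmod (w - a)).
  { assert (T := Cmod_triangle (w - a) (z - w)).
    replace (w - a + (z - w))%C with (z - a)%C in T by ring. fold p in T.
    rewrite (Cmod_minus_sym z w) in T. lra. }
  assert (Hwn : (w - a <> 0)%C) by (apply Cmod_gt_0; lra).
  replace (/ (w - a) - / (z - a) - - / ((z - a) * (z - a)) * (w - z))%C
    with ((w - z) * ((w - z) * / ((w - a) * ((z - a) * (z - a)))))%C by (field; auto).
  rewrite Cmod_mult, Rmult_comm. apply Rmult_le_compat_r; [apply Cmod_ge_0|].
  rewrite Cmod_mult, Cmod_inv by (repeat apply Cmult_neq_0; auto).
  rewrite !Cmod_mult. fold p.
  assert (Hpp : 0 < p * p) by nra.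
  change (Cmod (w - z) * / (Cmod (w - a) * (p * p))) with (Cmod (w - z) / (Cmod (w - a) * (p * p))).
  apply Rle_div_l; [nra|].
  apply Rle_trans with (eps * (p / 2 * (p * p))); [lra|].
  apply Rmult_le_compat_l; [lra|]. apply Rmult_le_compat_r; lra.
Qed.

Lemma cdiff_mult f g z l m : cdiff f z l -> cdiff g z m ->
  cdiff (fun w => f w * g w)%C z (l * g z + f z * m)%C.
Proof.
  intros Hf Hg eps He.
  assert (Pl := Cmod_ge_0 l). assert (Pm := Cmod_ge_0 m).
  assert (Pf := Cmod_ge_0 (f z)). assert (Pg := Cmod_ge_0 (g z)).
  (* [A], [B] and [E] allot [eps * |w - z| / 3] to each of the three error terms of the product
     rule; the summands 1 keep the denominators positive. *)
  set (A := 3 * (Cmod (g z) + Cmod m + 1)).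
  set (B := 3 * (Cmod (f z) + 1)).
  set (E := 3 * ((Cmod l + 1) * (Cmod m + 1))).
  assert (HA : 0 < A) by (unfold A; lra). assert (HB : 0 < B) by (unfold B; lra).
  assert (HE : 0 < E) by (unfold E; nra).
  destruct (Hf (eps / A)) as [d1 [Hd1 K1]]; [now apply Rdiv_lt_0_compat|].
  destruct (Hg (eps / B)) as [d2 [Hd2 K2]]; [now apply Rdiv_lt_0_compat|].
  destruct (cdiff_lipschitz g z m Hg) as [d3 [Hd3 K3]].
  assert (Hd4 : 0 < eps / E) by now apply Rdiv_lt_0_compat.
  exists (Rmin (Rmin d1 d2) (Rmin d3 (Rmin 1 (eps / E)))).
  split; [repeat apply Rmin_pos; lra|]. intros w Hw.
  assert (L1 := Rmin_l (Rmin d1 d2) (Rmin d3 (Rmin 1 (eps / E)))).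
  assert (L2 := Rmin_r (Rmin d1 d2) (Rmin d3 (Rmin 1 (eps / E)))).
  assert (L3 := Rmin_l d1 d2). assert (L4 := Rmin_r d1 d2).
  assert (L5 := Rmin_l d3 (Rmin 1 (eps / E))). assert (L6 := Rmin_r d3 (Rmin 1 (eps / E))).
  assert (L7 := Rmin_l 1 (eps / E)). assert (L8 := Rmin_r 1 (eps / E)).
  specialize (K1 w ltac:(lra)). specialize (K2 w ltac:(lra)). specialize (K3 w ltac:(lra)).
  replace (f w * g w - f z * g z - (l * g z + f z * m) * (w - z))%C
    with ((f w - f z - l * (w - z)) * g w + l * (w - z) * (g w - g z)
          + f z * (g w - g z - m * (w - z)))%C by ring.
  set (x := Cmod (w - z)) in *. assert (Px : 0 <= x) by apply Cmod_ge_0.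
  eapply Rle_trans; [apply Cmod_triangle|].
  eapply Rle_trans; [apply Rplus_le_compat_r, Cmod_triangle|].
  rewrite !Cmod_mult. fold x.
  assert (Gw : Cmod (g w) <= Cmod (g z) + Cmod m + 1).
  { replace (g w) with ((g w - g z) + g z)%C by ring.
    eapply Rle_trans; [apply Cmod_triangle|]. nra. }
  assert (T1 : Cmod (f w - f z - l * (w - z)) * Cmod (g w) <= eps * x / 3).
  { apply Rle_trans with (eps / A * x * (Cmod (g z) + Cmod m + 1)).
    - apply Rmult_le_compat; auto; apply Cmod_ge_0.
    - right. unfold A. field. lra. }
  assert (T3 : Cmod (f z) * Cmod (g w - g z - m * (w - z)) <= eps * x / 3).
  { apply Rle_trans with ((Cmod (f z) + 1) * (eps / B * x)).
    - apply Rmult_le_compat; auto; try lra. apply Cmod_ge_0.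
    - right. unfold B. field. lra. }
  assert (T2 : Cmod l * x * Cmod (g w - g z) <= eps * x / 3).
  { apply Rle_trans with ((Cmod l + 1) * x * ((Cmod m + 1) * x)).
    - apply Rmult_le_compat; auto; try apply Cmod_ge_0; nra.
    - apply Rle_trans with ((Cmod l + 1) * x * ((Cmod m + 1) * (eps / E))).
      + apply Rmult_le_compat_l; [nra|]. apply Rmult_le_compat_l; lra.
      + right. unfold E. field. lra. }
  lra.
Qed.

Definition chol (f : C -> C) : Prop := forall z, Cmod z < 1 -> exists l, cdiff f z l.

Lemma gam_pos rho a t : 0 < rho -> Cmod a < rho -> rho - Cmod a <= Cmod (gam rho a t).
Proof.
  intros H0 H. assert (T := Cmod_triangle (gam rho a t) a).
  replace (gam rho a t + a)%C with (rho * cis t)%C in T by (unfold gam; ring).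
  rewrite Cmod_mult, Cmod_R, Cmod_cis, Rabs_pos_eq in T; lra.
Qed.

Lemma gam_neq_0 rho a t : 0 < rho -> Cmod a < rho -> gam rho a t <> 0%C.
Proof.
  intros H0 H. apply Cmod_gt_0. assert (T := gam_pos rho a t H0 H). lra.
Qed.

Lemma Cmod_Phi_lt rho a s t : 0 <= s <= 1 -> 0 < rho < 1 -> Cmod a < rho ->
  Cmod (Phi rho a s t) < 1.
Proof.
  intros Hs Hr Ha.
  replace (Phi rho a s t) with ((1 - s) * a + s * (rho * cis t))%C by (unfold Phi, gam; ring).
  eapply Rle_lt_trans; [apply Cmod_triangle|].
  rewrite <- RtoC_minus, !Cmod_mult, !Cmod_R, Cmod_cis, !Rabs_pos_eq by lra. nra.
Qed.

Lemma cis_2PI : cis (2 * PI) = cis 0.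
Proof. unfold cis. now rewrite cos_2PI, sin_2PI, cos_0, sin_0. Qed.

(** Up to the factor [i], this is the integral of [(f z - f a) / (z - a)] over the circle. By
    Goursat it equals the integral over the curve at every height [s > 0]. Near [a] the quotient is
    bounded by differentiability alone and the curve has length proportional to [s], so the common
    value is 0, without any appeal to a removable singularity. *)
Lemma cauchy_quotient f rho a : chol f -> 0 < rho < 1 -> Cmod a < rho ->
  CInt (fun t => (f (rho * cis t) - f a) * (rho * cis t / gam rho a t))%C 0 (2 * PI) = 0%C.
Proof.
  intros Hf Hr Ha.
  assert (HPI := PI_RGT_0). assert (Ha0 := Cmod_ge_0 a).
  set (F := fun z => ((f z - f a) * / (z - a))%C).
  assert (HF : forall s, 0 < s -> hol_cone rho a F s 1).
  { intros s Hs x t Hx.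
    destruct (Hf (Phi rho a x t)) as [l Hl]; [apply Cmod_Phi_lt; auto; lra|].
    eexists. apply cdiff_mult.
    - apply cdiff_minus_const. exact Hl.
    - apply cdiff_inv_shift. intros E.
      assert (E2 : (x * gam rho a t = 0)%C).
      { replace (x * gam rho a t)%C with (Phi rho a x t - a)%C by (unfold Phi; ring).
        rewrite E. ring. }
      apply Cmult_integral in E2. destruct E2 as [E2|E2].
      + apply RtoC_inj in E2. lra.
      + now apply (gam_neq_0 rho a t). }
  (* The rays at angles [0] and [2 * PI] coincide, so the sides of constant [t] cancel and only the
     two closed curves remain. *)
  assert (HV : forall s1 s2, vint rho a F (2 * PI) s1 s2 = vint rho a F 0 s1 s2).
  { intros. unfold vint, Phi, gam. now rewrite cis_2PI. }
  assert (Hc : forall s, 0 < s <= 1 -> hint rho a F 1 0 (2 * PI) = hint rho a F s 0 (2 * PI)).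
  { intros s Hs. assert (G := goursat rho a F s 0 (1 - s) (2 * PI)).
    replace (s + (1 - s)) with 1 in G by ring. rewrite Rplus_0_l in G.
    specialize (G ltac:(lra) ltac:(lra) ltac:(lra) ltac:(lra) ltac:(lra) ltac:(lra)).
    specialize (G (HF s ltac:(lra))). unfold bint in G. rewrite HV in G.
    replace (hint rho a F 1 0 (2 * PI)) with
     ((hint rho a F 1 0 (2 * PI) - hint rho a F s 0 (2 * PI)
       - (vint rho a F 0 s 1 - vint rho a F 0 s 1)) + hint rho a F s 0 (2 * PI))%C by ring.
    rewrite G. ring. }
  assert (H0 : hint rho a F 1 0 (2 * PI) = 0%C).
  { destruct (Hf a ltac:(lra)) as [l Hl].
    destruct (cdiff_lipschitz f a l Hl) as [d [Hd K]].
    assert (Pl := Cmod_ge_0 l).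
    apply Cmod_eq_0. apply Rle_antisym; [|apply Cmod_ge_0].
    apply Rnot_lt_le. intros Hlt. set (x := Cmod (hint rho a F 1 0 (2 * PI))) in *.
    set (Bd := 4 * PI * (Cmod l + 1)).
    assert (HBd : 0 < Bd) by (unfold Bd; nra).
    assert (Hx : 0 < x / (2 * Bd)) by (apply Rdiv_lt_0_compat; lra).
    (* Every point of the curve is within [2s < d] of [a], and the bound [Bd * s] on the integral is
       at most half of its supposed modulus [x]. *)
    set (s := Rmin 1 (Rmin (d / 3) (x / (2 * Bd)))).
    assert (Hs0 : 0 < s) by (unfold s; repeat apply Rmin_pos; lra).
    assert (Q1 := Rmin_l 1 (Rmin (d / 3) (x / (2 * Bd)))).
    assert (Q2 := Rmin_r 1 (Rmin (d / 3) (x / (2 * Bd)))).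
    assert (Q3 := Rmin_l (d / 3) (x / (2 * Bd))).
    assert (Q4 := Rmin_r (d / 3) (x / (2 * Bd))).
    fold s in Q1, Q2.
    assert (Hle : Cmod (hint rho a F s 0 (2 * PI)) <= 2 * ((2 * PI - 0) * ((Cmod l + 1) * s))).
    { apply CInt_le; [lra| |].
      - intros t _. apply (ccont_hint rho a F s 1); [now apply HF | lra].
      - intros t _. rewrite !Cmod_mult, Cmod_dgam, Cmod_R, Rabs_pos_eq by lra.
        assert (HFb : Cmod (F (Phi rho a s t)) <= Cmod l + 1).
        { unfold F. assert (Hg := gam_pos rho a t ltac:(lra) Ha).
          assert (Hg2 := Cmod_gam rho a t ltac:(lra) ltac:(lra)).
          assert (E : (Phi rho a s t - a = s * gam rho a t)%C) by (unfold Phi; ring).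
          assert (EC : Cmod (Phi rho a s t - a) = s * Cmod (gam rho a t)).
          { rewrite E, Cmod_mult, Cmod_R, Rabs_pos_eq; lra. }
          assert (EP : 0 < Cmod (Phi rho a s t - a)) by (rewrite EC; apply Rmult_lt_0_compat; lra).
          rewrite Cmod_mult, Cmod_inv by now apply Cmod_gt_0.
          change (Cmod (f (Phi rho a s t) - f a) / Cmod (Phi rho a s t - a) <= Cmod l + 1).
          apply Rle_div_l; auto. apply K. rewrite EC.
          nra. }
        assert (P := Cmod_ge_0 (F (Phi rho a s t))).
        apply Rmult_le_compat; auto; nra. }
    rewrite <- (Hc s ltac:(lra)) in Hle. fold x in Hle.
    replace (2 * ((2 * PI - 0) * ((Cmod l + 1) * s))) with (Bd * s) in Hle by (unfold Bd; ring).
    assert (Q5 : s <= x / (2 * Bd)) by lra.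
    apply (Rle_div_r s x (2 * Bd)) in Q5; lra. }
  unfold hint in H0.
  rewrite (CInt_ext _ (fun t => Ci * ((f (rho * cis t) - f a) * (rho * cis t / gam rho a t)))%C) in H0.
  - rewrite CInt_scal in H0; [| lra |].
    + apply Cmult_integral in H0. destruct H0 as [H0|H0]; auto.
      exfalso. assert (Q := Cmod_Ci). rewrite H0, Cmod_0 in Q. lra.
    + intros t _.
      destruct (Hf (rho * cis t)%C) as [l Hl].
      { rewrite Cmod_mult, Cmod_R, Cmod_cis, Rabs_pos_eq; lra. }
      assert (Hrc : ccont (fun t => rho * cis t)%C t).
      { apply ccont_mult; [apply ccont_const | apply ccont_cis]. }
      apply ccont_mult.
      * apply ccont_minus; [|apply ccont_const].
        apply (ccont_comp f (fun t => rho * cis t)%C t l); auto.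
      * unfold Cdiv. apply ccont_mult; auto. apply ccont_inv.
        -- unfold gam. apply ccont_minus; auto. apply ccont_const.
        -- apply gam_neq_0; auto; lra.
  - lra.
  - intros t _. unfold F.
    replace (Phi rho a 1 t) with (rho * cis t)%C by (unfold Phi, gam; ring).
    unfold gam, dgam. field.
    apply (gam_neq_0 rho a t); auto; lra.
Qed.

(** * Fourier coefficients on a circle and the Taylor series *)

Definition ecis (t : R) : C := (cos t, - sin t).

Lemma cis_ecis t : (cis t * ecis t = 1)%C.
Proof.
  unfold cis, ecis, Cmult; simpl. apply injective_projections; simpl; [|ring].
  assert (H := sin2_cos2 t). unfold Rsqr in H. lra.
Qed.

Lemma ccont_ecis t : ccont ecis t.
Proof.
  split; simpl.
  - apply (ccont_cis t).
  - apply (continuous_opp (V := R_NormedModule) sin). apply (ccont_cis t).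
Qed.

Lemma Cmod_ecis t : Cmod (ecis t) = 1.
Proof.
  assert (H := f_equal Cmod (cis_ecis t)). rewrite Cmod_mult, Cmod_cis, Cmod_1 in H. lra.
Qed.

Lemma ecis_pow t k : (ecis t ^ k)%C = (cos (INR k * t), - sin (INR k * t)).
Proof.
  induction k.
  - simpl. rewrite Rmult_0_l, cos_0, sin_0. apply injective_projections; simpl; ring.
  - rewrite S_INR. replace ((INR k + 1) * t) with (INR k * t + t) by ring.
    rewrite cos_plus, sin_plus. simpl Cpow. rewrite IHk.
    unfold ecis, Cmult; simpl. apply injective_projections; simpl; ring.
Qed.

Lemma CInt_ecis_pow k : CInt (fun t => ecis t ^ k)%C 0 (2 * PI)
  = match k with O => RtoC (2 * PI) | S _ => 0%C end.
Proof.
  assert (HPI := PI_RGT_0).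
  destruct k as [|k].
  - rewrite (CInt_derive (fun t => RtoC t)).
    + rewrite <- RtoC_minus. f_equal. ring.
    + lra.
    + intros t _. split; simpl; [auto_derive; auto | apply (is_derive_const 0)].
    + intros t _. apply ccont_pow, ccont_ecis.
  - assert (Hn : INR (S k) <> 0) by (apply not_0_INR; lia).
    set (n := INR (S k)) in *.
    rewrite (CInt_derive (fun t => (sin (n * t) / n, cos (n * t) / n))).
    + assert (Es : sin (n * (2 * PI)) = 0).
      { replace (n * (2 * PI)) with (0 + 2 * INR (S k) * PI) by (unfold n; ring).
        rewrite sin_period. apply sin_0. }
      assert (Ec : cos (n * (2 * PI)) = 1).
      { replace (n * (2 * PI)) with (0 + 2 * INR (S k) * PI) by (unfold n; ring).
        rewrite cos_period. apply cos_0. }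
      rewrite Es, Ec, Rmult_0_r, sin_0, cos_0. apply injective_projections; simpl; ring.
    + lra.
    + intros t _. rewrite ecis_pow. fold n. split; unfold Re, Im; simpl fst; simpl snd.
      * auto_derive; auto. field. auto.
      * auto_derive; auto. field. auto.
    + intros t _. apply ccont_pow, ccont_ecis.
Qed.

Fixpoint psum (g : nat -> C) (K : nat) : C :=
  match K with O => 0%C | S m => (psum g m + g m)%C end.

Lemma psum_ext g g' K : (forall k, g k = g' k) -> psum g K = psum g' K.
Proof. intros H. induction K; simpl; auto. now rewrite IHK, H. Qed.

Lemma psum_minus g g' K : psum (fun k => g k - g' k)%C K = (psum g K - psum g' K)%C.
Proof. induction K; simpl; [ring|]. rewrite IHK. ring. Qed.

Lemma psum_first x K : psum (fun k => match k with O => x | S _ => 0%C end) (S K) = x.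
Proof. induction K; [simpl; ring|]. cbn [psum] in *. rewrite IHK. ring. Qed.

(** Iterates [w = 1 + (a / rho) e^(-it) w] for the Cauchy kernel
    [w = rho e^(it) / (rho e^(it) - a)]. The remainder stays exact, so no infinite sum is exchanged
    with an integral. *)
Lemma geometric_kernel_expansion (D : R -> C) rho a : 0 < rho -> Cmod a < rho ->
  ccont_on D 0 (2 * PI) -> forall K,
  CInt (fun t => D t * (rho * cis t / gam rho a t))%C 0 (2 * PI) =
  (psum (fun k => (a / rho) ^ k * CInt (fun t => D t * ecis t ^ k) 0 (2 * PI)) K
   + (a / rho) ^ K * CInt (fun t => D t * ecis t ^ K * (rho * cis t / gam rho a t)) 0 (2 * PI))%C.
Proof.
  intros Hr Ha HD. assert (HPI := PI_RGT_0).
  assert (Hrn : RtoC rho <> 0%C) by (intros E; apply RtoC_inj in E; lra).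
  assert (Hw : forall t, ccont (fun t => rho * cis t / gam rho a t)%C t).
  { intros t. assert (Hrc : ccont (fun t => rho * cis t)%C t).
    { apply ccont_mult; [apply ccont_const | apply ccont_cis]. }
    unfold Cdiv. apply ccont_mult; auto. apply ccont_inv.
    - unfold gam. apply ccont_minus; auto. apply ccont_const.
    - now apply gam_neq_0. }
  assert (HDk : forall k, ccont_on (fun t => D t * ecis t ^ k)%C 0 (2 * PI)).
  { intros k t Ht. apply ccont_mult; auto. apply ccont_pow, ccont_ecis. }
  assert (HDw : forall k, ccont_on (fun t => D t * ecis t ^ k * (rho * cis t / gam rho a t))%C 0 (2 * PI)).
  { intros k t Ht. apply ccont_mult; auto. now apply HDk. }
  induction K.
  - simpl. replace (CInt (fun t => D t * (rho * cis t / gam rho a t))%C 0 (2 * PI))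
      with (CInt (fun t => D t * 1 * (rho * cis t / gam rho a t))%C 0 (2 * PI)).
    + ring.
    + apply CInt_ext; [lra|]. intros t _. ring.
  - rewrite IHK.
    replace (CInt (fun t => D t * ecis t ^ K * (rho * cis t / gam rho a t))%C 0 (2 * PI))
     with (CInt (fun t => D t * ecis t ^ K) 0 (2 * PI) + (a / rho) *
       CInt (fun t => D t * ecis t ^ S K * (rho * cis t / gam rho a t)) 0 (2 * PI))%C.
    + cbn [psum Cpow]. ring.
    + rewrite <- CInt_scal, <- CInt_plus; auto; try lra.
      * apply CInt_ext; [lra|]. intros t _.
        assert (G := gam_neq_0 rho a t Hr Ha).
        assert (E : (rho * cis t / gam rho a t = 1 + a / gam rho a t)%C).
        { unfold gam in *. field. auto. }
        assert (E2 : (a / gam rho a t = a / rho * (ecis t * (rho * cis t / gam rho a t)))%C).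
        { replace (a / rho * (ecis t * (rho * cis t / gam rho a t)))%C
            with ((cis t * ecis t) * (a / gam rho a t))%C by (field; auto).
          rewrite cis_ecis. ring. }
        rewrite E at 2. rewrite E2. cbn [Cpow]. ring.
      * intros t Ht. apply ccont_mult; [apply ccont_const | now apply HDw].
Qed.

(** Cauchy's formula for the coefficients. The radius is a parameter; independence of it follows
    later from [ev_unique]. *)
Definition taylor (f : C -> C) (rho : R) (k : nat) : C :=
  (/ (2 * PI) * (/ rho ^ k * CInt (fun t => f (rho * cis t) * ecis t ^ k) 0 (2 * PI)))%C.

Lemma ev_psum R c z K : bnd R c -> Cmod z < R ->
  ev c z = (psum (fun k => c k * z ^ k) K + z ^ K * ev (fun k => c (K + k)%nat) z)%C.
Proof.
  intros Hc Hz. assert (H0 := Cmod_ge_0 z). induction K.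
  - change (fun k => c (0 + k)%nat) with c. simpl. ring.
  - rewrite IHK at 1. cbn [psum].
    rewrite (ev_incr_1 R (fun k => c (K + k)%nat)); auto; [|apply bnd_shift; auto; lra].
    rewrite Nat.add_0_r.
    rewrite (ev_ext (fun k => c (K + S k)%nat) (fun k => c (S K + k)%nat)).
    + cbn [Cpow]. ring.
    + intros k. f_equal. lia.
Qed.

Lemma le_geom_eq_0 (x A q : R) : 0 <= q < 1 -> 0 <= x -> (forall K, x <= A * q ^ S K) -> x = 0.
Proof.
  intros Hq Hx H. apply Rle_antisym; auto. apply Rnot_lt_le. intros Hlt.
  assert (HA : 0 <= A).
  { specialize (H 0%nat). simpl in H. destruct (Rle_lt_dec 0 A); auto. nra. }
  destruct (pow_lt_1_zero q) with (y := x / (A + 1)) as [K HK].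
  - rewrite Rabs_pos_eq; lra.
  - apply Rdiv_lt_0_compat; lra.
  - specialize (HK (S K) ltac:(lia)). rewrite Rabs_pos_eq in HK by (apply pow_le; lra).
    apply Rlt_div_r in HK; [|lra]. specialize (H K).
    assert (0 <= q ^ S K) by (apply pow_le; lra). nra.
Qed.

Lemma ccont_circle f rho t : chol f -> 0 < rho < 1 -> ccont (fun t => f (rho * cis t)%C) t.
Proof.
  intros Hf Hr. destruct (Hf (rho * cis t)%C) as [l Hl].
  { rewrite Cmod_mult, Cmod_R, Cmod_cis, Rabs_pos_eq; lra. }
  apply (ccont_comp f (fun t => rho * cis t)%C t l); auto.
  apply ccont_mult; [apply ccont_const | apply ccont_cis].
Qed.

Lemma bnd_taylor f rho : chol f -> 0 < rho < 1 -> bnd rho (taylor f rho).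
Proof.
  intros Hf Hr. assert (HPI := PI_RGT_0).
  destruct (ccont_on_bounded (fun t => f (rho * cis t)%C) 0 (2 * PI)) as [M HM].
  { lra. } { intros t _. now apply ccont_circle. }
  exists (/ (2 * PI) * (2 * ((2 * PI - 0) * M))). intros k.
  assert (HP : 0 < rho ^ k) by (apply pow_lt; lra).
  assert (B : Cmod (CInt (fun t => f (rho * cis t) * ecis t ^ k)%C 0 (2 * PI)) <= 2 * ((2 * PI - 0) * M)).
  { apply CInt_le; [lra| |].
    - intros t _. apply ccont_mult; [now apply ccont_circle | apply ccont_pow, ccont_ecis].
    - intros t Ht. rewrite Cmod_mult, Cmod_pow, Cmod_ecis, pow1, Rmult_1_r. now apply HM. }
  unfold taylor.
  assert (HPn : RtoC (2 * PI) <> 0%C) by (intros E; apply RtoC_inj in E; lra).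
  rewrite <- RtoC_mult, !Cmod_mult, Cmod_inv; auto.
  rewrite <- RtoC_pow, Cmod_inv, !Cmod_R, !Rabs_pos_eq; try lra.
  - set (x := Cmod (CInt (fun t => f (rho * cis t) * ecis t ^ k)%C 0 (2 * PI))) in *.
    replace (/ (2 * PI) * (/ rho ^ k * x) * rho ^ k) with (/ (2 * PI) * x) by (field; lra).
    apply Rmult_le_compat_l; auto. left. apply Rinv_0_lt_compat. lra.
  - intros E; apply RtoC_inj in E; lra.
Qed.

Lemma taylor_expansion f rho a : chol f -> 0 < rho < 1 -> Cmod a < rho ->
  f a = ev (taylor f rho) a.
Proof.
  intros Hf Hr Ha. assert (HPI := PI_RGT_0). assert (Ha0 := Cmod_ge_0 a).
  assert (Hrn : RtoC rho <> 0%C) by (intros E; apply RtoC_inj in E; lra).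
  assert (HPn : RtoC (2 * PI) <> 0%C) by (intros E; apply RtoC_inj in E; lra).
  set (D := fun t => (f (rho * cis t) - f a)%C).
  assert (HD : ccont_on D 0 (2 * PI)).
  { intros t _. apply ccont_minus; [now apply ccont_circle | apply ccont_const]. }
  assert (Hw : forall t, ccont (fun t => rho * cis t / gam rho a t)%C t).
  { intros t. assert (Hrc : ccont (fun t => rho * cis t)%C t).
    { apply ccont_mult; [apply ccont_const | apply ccont_cis]. }
    unfold Cdiv. apply ccont_mult; auto. apply ccont_inv.
    - unfold gam. apply ccont_minus; auto. apply ccont_const.
    - apply gam_neq_0; lra. }
  destruct (ccont_on_bounded D 0 (2 * PI)) as [M HM]; [lra | auto |].
  assert (HM0 : 0 <= M).
  { specialize (HM 0 ltac:(lra)). assert (H := Cmod_ge_0 (D 0)). lra. }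
  set (B := 2 * ((2 * PI - 0) * (M * (rho / (rho - Cmod a))))).
  assert (Rem : forall K, Cmod (CInt (fun t => D t * ecis t ^ K * (rho * cis t / gam rho a t))%C 0 (2 * PI)) <= B).
  { intros K. apply CInt_le; [lra| |].
    - intros t Ht. apply ccont_mult; auto. apply ccont_mult; auto. apply ccont_pow, ccont_ecis.
    - intros t Ht. rewrite !Cmod_mult, Cmod_pow, Cmod_ecis, pow1, Rmult_1_r.
      apply Rmult_le_compat; auto; try apply Cmod_ge_0.
      assert (G := gam_pos rho a t ltac:(lra) Ha).
      rewrite Cmod_div by (apply gam_neq_0; lra).
      rewrite Cmod_mult, Cmod_R, Cmod_cis, Rabs_pos_eq, Rmult_1_r by lra.
      apply Rmult_le_compat_l; [lra|]. apply Rinv_le_contravar; lra. }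
  set (q := Cmod a / rho).
  assert (Hq : 0 <= q < 1) by (apply ratio_lt_1; lra).
  destruct (bnd_taylor f rho Hf Hr) as [M' HM'].
  set (c := taylor f rho) in *.
  assert (Hc : bnd rho c) by now exists M'.
  (* The left side of the kernel expansion is 0 by [cauchy_quotient]. In the sum, the constant [f a]
     survives only at index 0, since [e^(-ikt)] has integral 0 for [k > 0]; hence [S K] terms, so
     that index 0 is present. *)
  assert (PS : forall K, (psum (fun k => c k * a ^ k) (S K) - f a =
     - / (2 * PI) * ((a / rho) ^ S K * CInt (fun t => D t * ecis t ^ S K * (rho * cis t / gam rho a t)) 0 (2 * PI)))%C).
  { intros K.
    assert (G := geometric_kernel_expansion D rho a ltac:(lra) Ha HD (S K)).
    unfold D at 1 in G. rewrite cauchy_quotient in G; auto.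
    set (I := CInt (fun t => D t * ecis t ^ S K * (rho * cis t / gam rho a t))%C 0 (2 * PI)) in *.
    rewrite (psum_ext _ (fun k => (2 * PI) * (c k * a ^ k) -
       match k with O => (2 * PI) * f a | S _ => 0 end)%C) in G.
    - rewrite psum_minus, psum_first in G.
      assert (E : psum (fun k => (2 * PI) * (c k * a ^ k))%C (S K) = ((2 * PI) * psum (fun k => c k * a ^ k) (S K))%C).
      { clear. induction (S K); simpl; [ring|]. rewrite IHn. ring. }
      rewrite E in G.
      set (P := psum (fun k => c k * a ^ k)%C (S K)) in *.
      set (J := ((a / rho) ^ S K * I)%C) in *.
      replace J with (- ((2 * PI) * (P - f a)))%C.
      + rewrite <- RtoC_mult in *. field. exact HPn.
      + replace J with ((2 * PI * P - 2 * PI * f a + J) - (2 * PI * P - 2 * PI * f a))%C by ring.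
        rewrite <- G. ring.
    - intros k.
      rewrite (CInt_ext _ (fun t => f (rho * cis t) * ecis t ^ k + (- f a) * ecis t ^ k)%C).
      + rewrite CInt_plus, CInt_scal, CInt_ecis_pow; try lra.
        * unfold c, taylor.
          set (X := CInt (fun t => f (rho * cis t) * ecis t ^ k)%C 0 (2 * PI)).
          assert (Ep : ((a / rho) ^ k = / rho ^ k * a ^ k)%C).
          { unfold Cdiv. rewrite Cpow_mult_l, Cpow_inv; auto. ring. }
          assert (Hpn : (rho ^ k <> 0)%C) by now apply Cpow_nz.
          rewrite <- RtoC_mult in *. rewrite Ep.
          destruct k; [simpl|]; field; auto.
        * intros t _. apply ccont_pow, ccont_ecis.
        * intros t _. apply ccont_mult; [now apply ccont_circle | apply ccont_pow, ccont_ecis].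
        * intros t _. apply ccont_mult; [apply ccont_const | apply ccont_pow, ccont_ecis].
      + lra.
      + intros t _. unfold D. ring. }
  (* Both the tail of the series and the remainder of the kernel expansion are bounded by a constant
     times [q^(K+1)]. *)
  assert (Z : Cmod (ev c a - f a) = 0).
  { apply le_geom_eq_0 with (A := 2 * (M' / (1 - q)) + / (2 * PI) * B) (q := q); auto; [apply Cmod_ge_0|].
    intros K. rewrite (ev_psum rho c a (S K)); auto.
    set (P := psum (fun k => c k * a ^ k)%C (S K)) in *.
    replace (P + a ^ S K * ev (fun k => c (S K + k)%nat) a - f a)%C
      with (a ^ S K * ev (fun k => c (S K + k)%nat) a + (P - f a))%C by ring.
    eapply Rle_trans; [apply Cmod_triangle|]. rewrite Rmult_plus_distr_r.
    apply Rplus_le_compat.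
    - rewrite Cmod_mult, Cmod_pow.
      assert (E := ev_le rho (M' / rho ^ S K) (fun k => c (S K + k)%nat) a (Cmod a)
        (bnd_by_shift rho M' c (S K) ltac:(lra) HM') (Rle_refl _) Ha).
      fold q in E.
      assert (HPk : 0 < rho ^ S K) by (apply pow_lt; lra).
      assert (HPa : 0 <= Cmod a ^ S K) by (apply pow_le; lra).
      apply Rle_trans with (Cmod a ^ S K * (2 * (M' / rho ^ S K / (1 - q)))).
      + now apply Rmult_le_compat_l.
      + right. replace (q ^ S K) with (Cmod a ^ S K * / rho ^ S K).
        * field. split; lra.
        * unfold q, Rdiv. now rewrite Rpow_mult_distr, pow_inv.
    - unfold P. rewrite PS, !Cmod_mult, Cmod_opp, Cmod_pow, Cmod_div by auto.
      rewrite <- RtoC_mult, Cmod_inv, !Cmod_R, !Rabs_pos_eq by (auto; lra).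
      fold q. rewrite Rmult_assoc. apply Rmult_le_compat_l.
      + left. apply Rinv_0_lt_compat. lra.
      + rewrite Rmult_comm. apply Rmult_le_compat_r; [apply pow_le; lra|]. apply Rem. }
  apply Cmod_eq_0 in Z. replace (ev c a) with ((ev c a - f a) + f a)%C by ring. rewrite Z. ring.
Qed.

(** The radius 1/2 fixes the sequence; for a larger radius the coefficients represent the same
    function on [|z| < 1/2], so they are the same. This makes one sequence bounded at every radius
    below 1. *)
Lemma holomorphic_power_series f : holomorphic_on unit_disk f ->
  exists c, (forall R, 0 < R -> R < 1 -> bnd R c) /\ forall z, unit_disk z -> f z = ev c z.
Proof.
  intros H.
  assert (Hf : chol f).
  { intros z Hz. destruct (H z Hz) as [l Hl]. exists l. now apply C_is_derive_cdiff. }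
  set (c := taylor f (/ 2)).
  assert (E : forall R, / 2 <= R -> R < 1 -> taylor f R = c).
  { intros R HR1 HR2. apply functional_extensionality.
    apply ev_unique with (/ 2); try lra.
    - apply bnd_le with R; try lra. apply bnd_taylor; auto; lra.
    - apply bnd_taylor; auto; lra.
    - intros z Hz. unfold c. rewrite <- !taylor_expansion; auto; lra. }
  exists c. split.
  - intros R HR0 HR1. destruct (Rle_lt_dec (/ 2) R).
    + rewrite <- (E R); auto. apply bnd_taylor; auto.
    + apply bnd_le with (/ 2); try lra. apply bnd_taylor; auto; lra.
  - intros z Hz. unfold unit_disk in Hz. assert (H0 := Cmod_ge_0 z).
    rewrite <- (E ((Cmod z + 1) / 2)) by lra.
    apply taylor_expansion; auto; lra.
Qed.

(** * Dividing out zeros *)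

Definition dn (k : nat) (c : nat -> C) : nat -> C := Nat.iter k dseq c.

Lemma bnd_dn k R R' c : 0 < R' -> R' < R -> bnd R c -> bnd R' (dn k c).
Proof.
  revert R'. induction k; intros R' H1 H2 Hc.
  - apply bnd_le with R; auto; lra.
  - simpl. apply bnd_dseq with ((R' + R) / 2); try lra. apply IHk; auto; lra.
Qed.

(** Leibniz' rule for a linear factor: [((z - a) h)^(k) = k h^(k-1) + (z - a) h^(k)]. For [k = 0]
    the truncated [pred k] is harmless because its factor is 0. *)
Lemma dn_mulX k a h j :
  dn k (mulX a h) j = (INR k * dn (pred k) h j + mulX a (dn k h) j)%C.
Proof.
  revert j. induction k; intros j.
  - simpl. ring.
  - change (dn (S k) (mulX a h) j) with (dseq (dn k (mulX a h)) j).
    unfold dseq at 1. rewrite IHk.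
    assert (E := dseq_mulX a (dn k h) j). unfold dseq at 1 in E.
    rewrite Cmult_plus_distr_l, E. cbn [pred].
    destruct k.
    + simpl. change (dseq h) with (dn 1 h). simpl INR. ring.
    + cbn [pred].
      change (dn (S (S k)) h) with (dseq (dn (S k) h)).
      change (dn (S k) h j) with (INR (S j) * dn k h (S j))%C.
      rewrite (S_INR (S k)), RtoC_plus. ring.
Qed.

Lemma ev_dn_mulX k R a h z : bnd R h -> Cmod z < R ->
  ev (dn k (mulX a h)) z = (INR k * ev (dn (pred k) h) z + (z - a) * ev (dn k h) z)%C.
Proof.
  intros Hh Hz. assert (H0 := Cmod_ge_0 z).
  set (t := (Cmod z + R) / 2).
  assert (Ht1 : Cmod z < t) by (unfold t; lra). assert (Ht2 : t < R) by (unfold t; lra).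
  assert (Hb : forall j, bnd t (dn j h)) by (intros j; apply bnd_dn with R; auto; lra).
  rewrite (ev_ext _ _ z (dn_mulX k a h)).
  rewrite (ev_plus t), (ev_scal t), (ev_mulX t); auto.
  - now apply bnd_scal.
  - apply bnd_mulX; auto. lra.
Qed.

Definition zero_dn (c : nat -> C) (a : C) (m : nat) : Prop :=
  forall k, (k < m)%nat -> ev (dn k c) a = 0%C.

(** At [z = a] Leibniz' rule leaves [(k + 1) h^(k)(a) = 0], so dividing by [z - a] lowers the
    multiplicity by just one. *)
Lemma zero_dn_mulX_same R a h m : bnd R h -> Cmod a < R ->
  zero_dn (mulX a h) a (S m) -> zero_dn h a m.
Proof.
  intros Hh Ha H k Hk. specialize (H (S k) ltac:(lia)).
  rewrite (ev_dn_mulX _ R) in H; auto. cbn [pred] in H.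
  replace (a - a)%C with (RtoC 0) in H by ring. rewrite Cmult_0_l, Cplus_0_r in H.
  apply Cmult_integral in H. destruct H as [H|H]; auto.
  exfalso. apply RtoC_inj in H. apply (not_0_INR (S k)); auto.
Qed.

(** By induction the term with [h^(k-1)(b)] vanishes, which leaves [(b - a) h^(k)(b) = 0]. Zeros
    elsewhere keep their multiplicity. *)
Lemma zero_dn_mulX_other R a b h m : bnd R h -> Cmod b < R -> a <> b ->
  zero_dn (mulX a h) b m -> zero_dn h b m.
Proof.
  intros Hh Hb Hab H k. induction k; intros Hk.
  - specialize (H 0%nat Hk). rewrite (ev_dn_mulX _ R) in H; auto.
    simpl INR in H. rewrite Cmult_0_l, Cplus_0_l in H.
    apply Cmult_integral in H. destruct H as [H|H]; auto.
    exfalso. apply Hab. replace b with (a + (b - a))%C by ring. rewrite H. ring.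
  - specialize (H (S k) Hk). rewrite (ev_dn_mulX _ R) in H; auto.
    cbn [pred] in H. rewrite IHk in H by lia. rewrite Cmult_0_r, Cplus_0_l in H.
    apply Cmult_integral in H. destruct H as [H|H]; auto.
    exfalso. apply Hab. replace b with (a + (b - a))%C by ring. rewrite H. ring.
Qed.

Fixpoint prodX (l : list C) (h : nat -> C) : nat -> C :=
  match l with nil => h | a :: l' => mulX a (prodX l' h) end.

Lemma bnd_prodX R l h : 0 < R -> bnd R h -> bnd R (prodX l h).
Proof. intros HR Hh. induction l; simpl; auto using bnd_mulX. Qed.

(** Outer induction on the distinct zeros, inner induction on the multiplicity of the first one,
    with one synthetic division per step. The resulting [pts] lists each zero as often as its
    recorded multiplicity. *)
Lemma zeros_factor R r (l : list (C * nat)) : r < R -> NoDup (map fst l) -> forall c,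
  bnd R c ->
  (forall am, In am l -> Cmod (fst am) <= r /\ zero_dn c (fst am) (snd am)) ->
  exists pts h, length pts = fold_right Nat.add 0%nat (map snd l) /\
    List.Forall (fun a : C => Cmod a <= r) pts /\ bnd R h /\ c = prodX pts h.
Proof.
  intros HrR. induction l as [|[a m] l IH]; intros Hnd c Hc Hz.
  - exists nil, c. split; [reflexivity|]. split; [constructor|]. now split.
  - inversion Hnd as [|x l' Hnin Hnd']; subst x l'. clear Hnd.
    revert c Hc Hz. induction m; intros c Hc Hz.
    + destruct (IH Hnd' c Hc) as [pts [h H]].
      { intros am Ham. apply Hz. now right. }
      exists pts, h. exact H.
    + destruct (Hz (a, S m) (or_introl eq_refl)) as [Ha Hza]. simpl in Ha, Hza.
      assert (HaR : Cmod a < R) by lra.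
      set (h := quotX a c).
      assert (Hh : bnd R h) by now apply bnd_quotX.
      assert (E : c = mulX a h).
      { apply functional_extensionality. intros k.
        rewrite (quotX_spec R a c Hc HaR k) at 1. fold h.
        specialize (Hza 0%nat ltac:(lia)). simpl in Hza.
        destruct k; [rewrite Hza|]; ring. }
      destruct (IHm h Hh) as [pts [h' [H1 [H2 [H3 H4]]]]].
      { intros [b j] [Hb|Hb].
        - injection Hb as <- <-. split; auto. simpl.
          apply zero_dn_mulX_same with R; auto. now rewrite <- E.
        - destruct (Hz (b, j) (or_intror Hb)) as [Hb1 Hb2]. simpl in *.
          split; auto. apply zero_dn_mulX_other with R a; auto; try lra.
          + intros ->. apply Hnin. apply in_map_iff. now exists (b, j).
          + now rewrite <- E. }
      exists (a :: pts), h'. split; [|split; [now constructor|split; [exact H3|]]].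
      * simpl in *. now rewrite H1.
      * rewrite E, H4. reflexivity.
Qed.

(** [zero_order_ge] quantifies over all derivative functions, so an actual one of each order below
    [m] must be exhibited. Order 0 has to be [f] itself, which agrees with the series on the disk
    only; the higher orders can be the differentiated series. *)
Lemma zero_order_ge_zero_dn f c a m :
  (forall R, 0 < R -> R < 1 -> bnd R c) ->
  (forall z, unit_disk z -> f z = ev c z) -> unit_disk a ->
  zero_order_ge unit_disk f a m -> zero_dn c a m.
Proof.
  intros Hc Hf Ha Hz k Hk.
  assert (Hd : forall k, exists d, is_nderiv unit_disk k f d /\
            forall z, unit_disk z -> d z = ev (dn k c) z).
  { clear k Hk. induction k as [|k [d [Hd1 Hd2]]].
    - exists f. split; [constructor | exact Hf].
    - exists (ev (dn (S k) c)). split; auto.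
      apply nderiv_S with d; auto.
      intros z Hzz. apply C_is_derive_cdiff.
      unfold unit_disk in *. assert (H0 := Cmod_ge_0 z).
      apply cdiff_ext with (f := ev (dn k c)) (rho := 1 - Cmod z).
      + lra.
      + intros w Hw. symmetry. apply Hd2.
        assert (T := Cmod_triangle (w - z) z).
        replace (w - z + z)%C with w in T by ring. lra.
      + apply cdiff_ev with ((Cmod z + 1) / 2); [|lra].
        apply bnd_dn with ((Cmod z + 3) / 4); try lra. apply Hc; lra. }
  destruct (Hd k) as [d [Hd1 Hd2]].
  rewrite <- Hd2; auto. now apply (Hz k).
Qed.

(** * The Blaschke estimate in Hardy norms *)

Definition sqterm (t : R) (c : nat -> C) (k : nat) : R := (Cmod (c k) * t ^ k) ^ 2.

(** By Parseval this is the mean of [|ev c|^2] over [|z| = t], the squared Hardy norm; it is handled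
    purely as a series. *)
Definition sqn (t : R) (c : nat -> C) : R := Series (sqterm t c).

Lemma sqterm_pos t c k : 0 <= sqterm t c k.
Proof. apply pow2_ge_0. Qed.

Lemma sqterm_le R M t c k : 0 <= t -> 0 < R -> bnd_by R M c ->
  sqterm t c k <= M ^ 2 * ((t / R) ^ 2) ^ k.
Proof.
  intros Ht HR HM. unfold sqterm.
  assert (HP : 0 < R ^ k) by now apply pow_lt.
  assert (Htk : 0 <= t ^ k) by now apply pow_le.
  assert (E : Cmod (c k) * t ^ k <= M * (t / R) ^ k).
  { unfold Rdiv. rewrite Rpow_mult_distr, pow_inv.
    replace (Cmod (c k) * t ^ k) with ((Cmod (c k) * R ^ k) * (t ^ k * / R ^ k)) by (field; lra).
    apply Rmult_le_compat_r; [|apply HM].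
    apply Rmult_le_pos; auto. left. now apply Rinv_0_lt_compat. }
  replace (M ^ 2 * ((t / R) ^ 2) ^ k) with ((M * (t / R) ^ k) ^ 2).
  - apply pow_incr. split; auto. apply Rmult_le_pos; auto. apply Cmod_ge_0.
  - rewrite Rpow_mult_distr, <- 2!pow_mult. f_equal. f_equal. lia.
Qed.

Lemma ex_sqn R t c : 0 <= t -> t < R -> bnd R c -> ex_series (sqterm t c).
Proof.
  intros Ht HR [M HM].
  apply (@ex_series_le R_AbsRing R_CompleteNormedModule)
    with (b := fun k => M ^ 2 * ((t / R) ^ 2) ^ k).
  - intros n. unfold norm; simpl; unfold abs; simpl.
    rewrite Rabs_pos_eq by apply sqterm_pos. apply sqterm_le; auto; lra.
  - apply ex_series_geom_scal. assert (H := ratio_lt_1 R t Ht HR). nra.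
Qed.

(** Coefficients of [(R - conj a z / R) h(z)], the factor whose modulus equals that of [z - a] on
    [|z| = R]. *)
Definition mulB (R : R) (a : C) (h : nat -> C) (k : nat) : C :=
  match k with
  | O => (R * h O)%C
  | S j => (R * h (S j) - Cconj a / R * h j)%C
  end.

Lemma bnd_mulB R R0 a h : 0 < R0 -> bnd R0 h -> bnd R0 (mulB R a h).
Proof.
  intros HR Hh.
  apply bnd_ext with (fun k => R * h k + (- (Cconj a / R)) * mulX 0 h k)%C.
  - intros [|k]; cbn [mulX mulB]; ring.
  - apply bnd_plus; auto using bnd_scal, bnd_mulX.
Qed.

Lemma mulB_mulX R a b h k : R <> 0 -> mulB R a (mulX b h) k = mulX b (mulB R a h) k.
Proof.
  intros HR. assert (RtoC R <> 0%C) by (intros E; now apply RtoC_inj in E).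
  destruct k as [|[|k]]; cbn [mulX mulB]; field; auto.
Qed.

Lemma mulB_prodX R a l h : R <> 0 -> mulB R a (prodX l h) = prodX l (mulB R a h).
Proof.
  intros HR. induction l; simpl; auto.
  rewrite <- IHl. apply functional_extensionality. intros k. now apply mulB_mulX.
Qed.

Lemma Cmod2_sum (z : C) : Cmod z ^ 2 = fst z ^ 2 + snd z ^ 2.
Proof. exact (Cmod2_alt z). Qed.

(* Pointwise form of [|R - conj a z / R|^2 - |z - a|^2 = (R^2 - |z|^2) (1 - |a|^2/R^2)]. *)
Lemma blaschke_term R a (u v : C) : R <> 0 ->
  Cmod (R * u - Cconj a / R * v) ^ 2 - Cmod (v - a * u) ^ 2
  = (R ^ 2 - Cmod a ^ 2) * Cmod u ^ 2 - (1 - Cmod a ^ 2 / R ^ 2) * Cmod v ^ 2.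
Proof.
  intros HR. rewrite !Cmod2_sum. destruct a as [a1 a2], u as [u1 u2], v as [v1 v2].
  unfold Cdiv, Cinv, Cconj; simpl. field; auto.
Qed.

(** Summing [blaschke_term] against [t^(2k)], the index shift turns one of the two terms into
    [t^2 * sqn t h]. The correction vanishes for [t = R], and for [t < R] and [|a| < R] it measures
    the gain. *)
Lemma sqn_mulB R0 R t a h : 0 < R -> 0 < t -> t < R0 -> bnd R0 h ->
  sqn t (mulB R a h) =
  sqn t (mulX a h) + (1 - Cmod a ^ 2 / R ^ 2) * (R ^ 2 - t ^ 2) * sqn t h.
Proof.
  intros HR Ht HtR Hh.
  assert (HB : ex_series (sqterm t (mulB R a h))) by (apply ex_sqn with R0; try lra; apply bnd_mulB; auto; lra).
  assert (HX : ex_series (sqterm t (mulX a h))) by (apply ex_sqn with R0; try lra; apply bnd_mulX; auto; lra).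
  assert (Hs : ex_series (sqterm t h)) by (apply ex_sqn with R0; auto; lra).
  assert (E : sqn t (mulB R a h) - sqn t (mulX a h) =
    (R ^ 2 - Cmod a ^ 2) * sqn t h - (1 - Cmod a ^ 2 / R ^ 2) * (t ^ 2 * sqn t h)).
  { unfold sqn. rewrite <- Series_minus; auto.
    rewrite Series_incr_1.
    2:{ apply ex_series_ext with (2 := ex_series_minus _ _ HB HX). reflexivity. }
    rewrite (Series_ext (fun k => sqterm t (mulB R a h) (S k) - sqterm t (mulX a h) (S k))
      (fun k => (R ^ 2 - Cmod a ^ 2) * sqterm t h (S k)
         - (1 - Cmod a ^ 2 / R ^ 2) * t ^ 2 * sqterm t h k)).
    - assert (Hs' : ex_series (fun k => sqterm t h (S k))) by now apply (ex_series_incr_1 (sqterm t h)).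
      rewrite Series_minus, !Series_scal_l.
      + rewrite (Series_incr_1 (sqterm t h)) at 2; auto.
        unfold sqterm at 1 2 5. cbn [mulB mulX].
        (* The constant term fits the same identity with [v = 0], as if [h] had a zero coefficient
           of index -1. *)
        assert (E0 := blaschke_term R a (h 0%nat) 0 ltac:(lra)).
        replace (R * h 0%nat - Cconj a / R * 0)%C with (R * h 0%nat)%C in E0 by ring.
        replace (0 - a * h 0%nat)%C with (- a * h 0%nat)%C in E0 by ring.
        rewrite Cmod_0 in E0. simpl (t ^ 0). rewrite !Rmult_1_r. nra.
      + now apply ex_series_Rscal.
      + now apply ex_series_Rscal.
    - intros k. unfold sqterm. cbn [mulB mulX].
      assert (E0 := blaschke_term R a (h (S k)) (h k) ltac:(lra)).
      rewrite !Rpow_mult_distr. simpl (t ^ S k). rewrite !Rpow_mult_distr.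
      rewrite <- Rmult_minus_distr_r, E0. ring. }
  assert (E2 : sqn t (mulB R a h) = sqn t (mulX a h) +
     ((R ^ 2 - Cmod a ^ 2) * sqn t h - (1 - Cmod a ^ 2 / R ^ 2) * (t ^ 2 * sqn t h))) by lra.
  rewrite E2. field. lra.
Qed.

Lemma sqn_pos t c R0 : 0 <= t -> t < R0 -> bnd R0 c -> 0 <= sqn t c.
Proof.
  intros H1 H2 H3. unfold sqn.
  rewrite <- (Rmult_0_l (Series (sqterm t c))), <- Series_scal_l.
  apply Series_le; [|now apply ex_sqn with R0].
  intros n. assert (H := sqterm_pos t c n). lra.
Qed.

(** The quadratic-mean form of [|z - a| <= 2r]. It is read backwards, as a lower bound for
    [sqn r h], in the next estimate. *)
Lemma sqn_mulX_le R0 r a h : 0 < r -> r < R0 -> Cmod a <= r -> bnd R0 h ->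
  sqn r (mulX a h) <= 4 * r ^ 2 * sqn r h.
Proof.
  intros Hr HR Ha Hh.
  assert (Hs : ex_series (sqterm r h)) by (apply ex_sqn with R0; auto; lra).
  assert (Hs' : ex_series (fun k => sqterm r h (S k))) by now apply (ex_series_incr_1 (sqterm r h)).
  assert (HX : ex_series (sqterm r (mulX a h))) by (apply ex_sqn with R0; try lra; apply bnd_mulX; auto; lra).
  unfold sqn. rewrite Series_incr_1; auto.
  assert (Ha0 := Cmod_ge_0 a).
  assert (B0 : sqterm r (mulX a h) 0 <= 2 * r ^ 2 * sqterm r h 0).
  { unfold sqterm. cbn [mulX]. rewrite Cmod_mult, Cmod_opp. simpl (r ^ 0). rewrite !Rmult_1_r.
    rewrite Rpow_mult_distr. assert (H := pow2_ge_0 (Cmod (h 0%nat))).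
    assert (Cmod a ^ 2 <= r ^ 2) by (apply pow_incr; lra).
    assert (H1 := pow2_ge_0 r). nra. }
  assert (B1 : Series (fun k => sqterm r (mulX a h) (S k)) <=
     2 * r ^ 2 * Series (sqterm r h) + 2 * r ^ 2 * Series (fun k => sqterm r h (S k))).
  { rewrite <- 2!Series_scal_l, <- Series_plus by now apply ex_series_Rscal.
    apply Series_le.
    - intros k. split; [apply sqterm_pos|].
      unfold sqterm. cbn [mulX].
      assert (T := Cmod_triangle_minus (h k) (a * h (S k))).
      rewrite Cmod_mult in T.
      assert (Hrk : 0 < r ^ S k) by now apply pow_lt.
      set (x := Cmod (h k)) in *. set (y := Cmod (h (S k))) in *.
      set (w := Cmod (h k - a * h (S k))) in *.
      assert (Hx : 0 <= x) by apply Cmod_ge_0. assert (Hy : 0 <= y) by apply Cmod_ge_0.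
      assert (Hw : 0 <= w) by apply Cmod_ge_0.
      assert (W : w <= x + r * y) by nra.
      assert (W2 : w ^ 2 <= 2 * x ^ 2 + 2 * r ^ 2 * y ^ 2).
      { apply Rle_trans with ((x + r * y) ^ 2); [apply pow_incr; lra|].
        assert (H := pow2_ge_0 (x - r * y)). nra. }
      rewrite !Rpow_mult_distr.
      replace (2 * r ^ 2 * (x ^ 2 * (r ^ k) ^ 2) + 2 * r ^ 2 * (y ^ 2 * (r ^ S k) ^ 2))
        with ((2 * x ^ 2 + 2 * r ^ 2 * y ^ 2) * (r ^ S k) ^ 2) by (simpl; ring).
      apply Rmult_le_compat_r; auto. apply pow2_ge_0.
    - apply (ex_series_plus (V := R_NormedModule)
        (fun k => 2 * r ^ 2 * sqterm r h k) (fun k => 2 * r ^ 2 * sqterm r h (S k)));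
      now apply ex_series_Rscal. }
  rewrite (Series_incr_1 (sqterm r h)) in *; auto. lra.
Qed.

(** The largest value of [|t (z - a) / (t^2 - conj a z)|^2] for [|z|, |a| <= r < t], attained at
    [z = -r], [a = r]. *)
Definition kappa (r t : R) : R := 4 * t ^ 2 * r ^ 2 / (t ^ 2 + r ^ 2) ^ 2.

Lemma kappa_pos r R : 0 < r -> 0 < R -> 0 < kappa r R.
Proof.
  intros. unfold kappa.
  assert (0 < r ^ 2) by now apply pow_lt. assert (0 < R ^ 2) by now apply pow_lt.
  apply Rdiv_lt_0_compat; [nra|]. apply pow_lt. lra.
Qed.

Lemma sqn_mulX_mulB R0 R r a h : 0 < r -> r < R -> R < R0 -> Cmod a <= r -> bnd R0 h ->
  sqn r (mulX a h) <= kappa r R * sqn r (mulB R a h).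
Proof.
  intros Hr HrR HR Ha Hh.
  rewrite (sqn_mulB R0); auto; try lra.
  assert (B := sqn_mulX_le R0 r a h Hr ltac:(lra) Ha Hh).
  assert (HS := sqn_pos r h R0 ltac:(lra) ltac:(lra) Hh).
  assert (Ha0 := Cmod_ge_0 a).
  assert (Hr2 : 0 < r ^ 2) by now apply pow_lt.
  assert (HR2 : r ^ 2 < R ^ 2) by nra.
  assert (Ha2 : Cmod a ^ 2 <= r ^ 2) by (apply pow_incr; lra).
  set (X := sqn r (mulX a h)) in *. set (H := sqn r h) in *.
  set (p := r ^ 2) in *. set (q := R ^ 2) in *. set (s := Cmod a ^ 2) in *.
  assert (Hk : 0 < kappa r R) by (apply kappa_pos; lra).
  assert (L : (1 - p / q) * (q - p) * H <= (1 - s / q) * (q - p) * H).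
  { apply Rmult_le_compat_r; auto. apply Rmult_le_compat_r; [lra|].
    assert (s / q <= p / q) by (apply Rmult_le_compat_r; auto; left; apply Rinv_0_lt_compat; lra).
    lra. }
  apply Rle_trans with (kappa r R * (X + (1 - p / q) * (q - p) * H)).
  2:{ apply Rmult_le_compat_l; lra. }
  (* An equality: [1 + (1 - p/q)(q - p) / (4p) = (p + q)^2 / (4pq)], the inverse of [kappa r R]. The
     next step uses [X <= 4p H]. *)
  apply Rle_trans with (kappa r R * (X + (1 - p / q) * (q - p) * (X / (4 * p)))).
  - right. unfold kappa. fold p q. field. repeat split; try lra; nra.
  - apply Rmult_le_compat_l; [lra|]. apply Rplus_le_compat_l.
    apply Rmult_le_compat_l.
    + apply Rmult_le_pos; [|lra].
      assert (p / q < 1) by (apply Rlt_div_l; lra). lra.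
    + apply Rle_div_l; lra.
Qed.

(** Factors are exchanged one at a time. The new factor commutes with the remaining ones and is
    moved into [h], which is why the induction is over all [h]; the base case is monotonicity of
    [sqn] in the radius. *)
Lemma sqn_prodX R0 R r l : 0 < r -> r < R -> R < R0 ->
  List.Forall (fun a : C => Cmod a <= r) l -> forall h, bnd R0 h ->
  sqn r (prodX l h) <= kappa r R ^ length l * sqn R (prodX l h).
Proof.
  intros Hr HrR HR Hl. induction Hl as [|a l Ha Hl IH]; intros h Hh; simpl.
  - rewrite Rmult_1_l. unfold sqn. apply Series_le; [|apply ex_sqn with R0; auto; lra].
    intros k. split; [apply sqterm_pos|]. unfold sqterm. apply pow_incr.
    assert (H := Cmod_ge_0 (h k)). assert (0 <= r ^ k) by (apply pow_le; lra).
    split; [nra|]. apply Rmult_le_compat_l; auto. apply pow_incr; lra.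
  - assert (Hp : bnd R0 (prodX l h)) by (apply bnd_prodX; auto; lra).
    assert (Hb : bnd R0 (mulB R a h)) by (apply bnd_mulB; auto; lra).
    assert (Hk : 0 < kappa r R) by (apply kappa_pos; lra).
    eapply Rle_trans; [apply (sqn_mulX_mulB R0 R); auto|].
    rewrite Rmult_assoc. apply Rmult_le_compat_l; [lra|].
    assert (E : sqn R (mulX a (prodX l h)) = sqn R (mulB R a (prodX l h))).
    { rewrite (sqn_mulB R0); auto; try lra. }
    rewrite E, mulB_prodX by lra. now apply IH.
Qed.

(** * Coefficient estimates *)

Definition tail (t : R) (c : nat -> C) (n k : nat) : R :=
  if le_lt_dec k n then 0 else sqterm t c k.

Lemma tail_pos t c n k : 0 <= tail t c n k <= sqterm t c k.
Proof.
  unfold tail. assert (H := sqterm_pos t c k). destruct (le_lt_dec k n); lra.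
Qed.

Lemma ex_tail R t c n : 0 <= t -> t < R -> bnd R c -> ex_series (tail t c n).
Proof.
  intros H1 H2 H3.
  apply (@ex_series_le R_AbsRing R_CompleteNormedModule) with (b := sqterm t c).
  - intros k. unfold norm; simpl; unfold abs; simpl. assert (H := tail_pos t c n k).
    rewrite Rabs_pos_eq; lra.
  - now apply ex_sqn with R.
Qed.

Lemma sqterm_le_sqn R t c k : 0 <= t -> t < R -> bnd R c -> sqterm t c k <= sqn t c.
Proof.
  intros H1 H2 H3. assert (Hs := ex_sqn R t c H1 H2 H3).
  unfold sqn.
  replace (sqterm t c k) with (Series (fun j => if Nat.eq_dec j k then sqterm t c k else 0)).
  - apply Series_le; auto. intros j. assert (H := sqterm_pos t c j).
    destruct (Nat.eq_dec j k); subst; lra.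
  - rewrite (Series_incr_n _ (S k)); try lia.
    + rewrite (Series_ext _ (fun _ => 0 * 0)), Series_scal_l, Rmult_0_l, Rplus_0_r.
      * simpl pred. destruct k.
        -- simpl. reflexivity.
        -- rewrite tech5. destruct (Nat.eq_dec (S k) (S k)); [|lia].
           rewrite (sum_eq_R0 _ k); [lra|].
           intros j Hj. destruct (Nat.eq_dec j (S k)); [lia|reflexivity].
      * intros j. destruct (Nat.eq_dec (S k + j) k); [lia|lra].
    + apply (@ex_series_le R_AbsRing R_CompleteNormedModule) with (2 := Hs).
      intros j. unfold norm; simpl; unfold abs; simpl. assert (H := sqterm_pos t c j).
      destruct (Nat.eq_dec j k); subst; rewrite Rabs_pos_eq; lra.
Qed.

Lemma sqterm_low r R n k c : 0 < r -> r <= R -> (k <= n)%nat ->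
  sqterm R c k <= ((R / r) ^ 2) ^ n * sqterm r c k.
Proof.
  intros Hr HR Hk. unfold sqterm.
  assert (Hq : 1 <= R / r) by (apply Rle_div_intro; lra).
  replace ((Cmod (c k) * R ^ k) ^ 2) with (((R / r) ^ 2) ^ k * (Cmod (c k) * r ^ k) ^ 2).
  - apply Rmult_le_compat_r; [apply pow2_ge_0|]. apply Rle_pow; auto. nra.
  - rewrite <- pow_mult, Nat.mul_comm, pow_mult, <- Rpow_mult_distr. f_equal.
    unfold Rdiv. rewrite Rpow_mult_distr, pow_inv. field. apply pow_nonzero. lra.
Qed.

Lemma coefficient_decay R0 R r (c u : nat -> C) n l h : 0 < r -> r < R -> R < R0 -> bnd R0 c ->
  (forall k, (n < k)%nat -> u k = 0%C) ->
  List.Forall (fun a : C => Cmod a <= r) l -> bnd R0 h ->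
  (fun k => c k - u k)%C = prodX l h ->
  kappa r R ^ length l * ((R / r) ^ 2) ^ n <= / 2 ->
  forall k, (n < k)%nat ->
    sqterm r c k <= 2 * kappa r R ^ length l * Series (tail R c n).
Proof.
  intros Hr HrR HR Hc Hu Hl Hh E Hk k Hnk.
  set (g := (fun k => c k - u k)%C) in *.
  assert (Hg : bnd R0 g) by (rewrite E; apply bnd_prodX; auto; lra).
  assert (Hgc : forall t j, (n < j)%nat -> sqterm t g j = sqterm t c j).
  { intros t j Hj. unfold sqterm, g. rewrite Hu by auto. do 3 f_equal. ring. }
  assert (B := sqn_prodX R0 R r l Hr HrR HR Hl h Hh). rewrite <- E in B.
  set (K := kappa r R ^ length l) in *. set (Q := ((R / r) ^ 2) ^ n) in *.
  assert (HK : 0 < K) by (apply pow_lt, kappa_pos; lra).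
  assert (HQ : 0 < Q) by (apply pow_lt, pow_lt, Rdiv_lt_0_compat; lra).
  assert (B2 : sqn R g <= Q * sqn r g + Series (tail R c n)).
  { unfold sqn. rewrite <- Series_scal_l, <- Series_plus.
    - apply Series_le.
      + intros j. split; [apply sqterm_pos|]. unfold tail.
        assert (H := sqterm_pos r g j).
        destruct (le_lt_dec j n).
        * rewrite Rplus_0_r. apply sqterm_low; auto; lra.
        * rewrite Hgc by auto. nra.
      + apply (ex_series_plus (V := R_NormedModule) (fun j => Q * sqterm r g j)).
        * apply ex_series_Rscal, ex_sqn with R0; auto; lra.
        * apply ex_tail with R0; auto; lra.
    - apply ex_series_Rscal, ex_sqn with R0; auto; lra.
    - apply ex_tail with R0; auto; lra. }
  assert (B3 := sqterm_le_sqn R0 r g k ltac:(lra) ltac:(lra) Hg).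
  rewrite Hgc in B3 by auto.
  assert (B4 := sqn_pos r g R0 ltac:(lra) ltac:(lra) Hg).
  assert (B5 : K * sqn R g <= K * (Q * sqn r g + Series (tail R c n))).
  { apply Rmult_le_compat_l; lra. }
  (* Half of [sqn r g] is absorbed into the left side of [B], whence [sqn r g <= 2 K T]. *)
  assert (B6 : K * Q * sqn r g <= / 2 * sqn r g) by (apply Rmult_le_compat_r; auto).
  nra.
Qed.

(** * From many zeros to a larger radius, then to vanishing coefficients *)

Lemma kappa_lt_1 r R : 0 < r -> r < R -> kappa r R < 1.
Proof.
  intros Hr HR. unfold kappa.
  assert (0 < r ^ 2) by now apply pow_lt. assert (r ^ 2 < R ^ 2) by nra.
  apply Rlt_div_l; [apply pow_lt; lra|]. nra.
Qed.

Lemma pow_le_pow_lt1 x m n : 0 < x < 1 -> (m <= n)%nat -> x ^ n <= x ^ m.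
Proof.
  intros Hx H. replace n with (m + (n - m))%nat by lia. rewrite pow_add.
  rewrite <- (Rmult_1_r (x ^ m)) at 2. apply Rmult_le_compat_l; [apply pow_le; lra|].
  rewrite <- (pow1 (n - m)). apply pow_incr; lra.
Qed.

(* [f] has coefficients [c], and for [n >= n0] some [f - p] with [deg p <= n] has at least
   [m n] zeros in the closed disk of radius [r]; stated after dividing these zeros out. *)
Definition many_zeros (c : nat -> C) (r : R) (m n0 : nat) : Prop :=
  forall R0 n, r < R0 -> bnd R0 c -> (n0 <= n)%nat -> (0 < n)%nat ->
  exists (u : nat -> C) l h, (forall k, (n < k)%nat -> u k = 0%C) /\
    List.Forall (fun a : C => Cmod a <= r) l /\ bnd R0 h /\
    (fun k => c k - u k)%C = prodX l h /\ (m * n <= length l)%nat.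

Lemma eventually_bounded (b : nat -> R) M n0 :
  (forall n, (n0 <= n)%nat -> b n <= M) -> exists M', forall n, b n <= M'.
Proof.
  revert M. induction n0; intros M H.
  - exists M. intros n. apply H. lia.
  - apply (IHn0 (Rmax M (b n0))). intros n Hn.
    destruct (Nat.eq_dec n n0) as [->|]; [apply Rmax_r|].
    eapply Rle_trans; [apply H; lia | apply Rmax_l].
Qed.

(** Only index [n + 1] of the decay estimate is used, with [n] varying: each [n] bounds one
    coefficient. *)
Lemma radius_enlarged c r R0 : 0 < r -> r < R0 -> bnd R0 c ->
  (forall m, exists n0, many_zeros c r m n0) -> bnd (32 * r) c.
Proof.
  intros Hr HR0 Hc Hz.
  set (R := (r + R0) / 2). assert (HrR : r < R) by (unfold R; lra).
  assert (HR : R < R0) by (unfold R; lra).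
  set (Q := (R / r) ^ 2).
  assert (HQ : 0 < Q) by (apply pow_lt, Rdiv_lt_0_compat; lra).
  assert (HQ1 : 1 <= Q).
  { apply pow_R1_Rle. apply Rle_div_intro; lra. }
  assert (Hk0 := kappa_pos r R Hr ltac:(lra)). assert (Hk1 := kappa_lt_1 r R Hr HrR).
  set (K := kappa r R) in *.
  (* In the [n]-th power, [2 * Q] secures the hypothesis of [coefficient_decay], and [1024 = 32^2]
     turns the radius [r] into [32 * r]. *)
  assert (Hm : exists m, K ^ m <= / (2 * Q * 1024)).
  { destruct (pow_lt_1_zero K) with (y := / (2 * Q * 1024)) as [m Hm].
    - rewrite Rabs_pos_eq; lra.
    - apply Rinv_0_lt_compat. lra.
    - exists m. specialize (Hm m (le_n _)). rewrite Rabs_pos_eq in Hm; [lra|].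
      apply pow_le; lra. }
  destruct Hm as [m Hm]. destruct (Hz m) as [n0 Hn0].
  set (B := sqn R c).
  assert (HB : 0 <= B) by (apply sqn_pos with R0; auto; lra).
  (* From index [n0 + 2] on, [k = n + 1] has both [n >= n0] and [n > 0]. *)
  destruct (eventually_bounded (fun k => Cmod (c k) * (32 * r) ^ k) (1 + 2048 * B) (S (S n0)))
    as [M HM]; [|now exists M].
  intros k Hk. destruct k as [|n]; [lia|].
  destruct (Hn0 R0 n HR0 Hc ltac:(lia) ltac:(lia)) as [u [l [h [Hu [Hl [Hh [E HN]]]]]]].
  assert (HKN : K ^ length l <= (/ (2 * Q * 1024)) ^ n).
  { apply Rle_trans with (K ^ (m * n)); [apply pow_le_pow_lt1; auto|].
    rewrite pow_mult. apply pow_incr. split; auto. apply pow_le; lra. }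
  assert (HQn : 0 < Q ^ n) by now apply pow_lt.
  assert (H2n : (/ 2) ^ n <= / 2).
  { rewrite <- (pow_1 (/2)) at 2. apply pow_le_pow_lt1; [lra|lia]. }
  assert (H2n0 : 0 < (/ 2) ^ n) by (apply pow_lt; lra).
  assert (H3n0 : 0 < (/ 1024) ^ n) by (apply pow_lt; lra).
  assert (H3n : (/ 1024) ^ n <= 1) by (rewrite <- (pow1 n); apply pow_incr; lra).
  assert (E3 : (/ (2 * Q * 1024)) ^ n * Q ^ n = (/ 2) ^ n * (/ 1024) ^ n).
  { rewrite <- !Rpow_mult_distr. f_equal. field. lra. }
  assert (D := coefficient_decay R0 R r c u n l h Hr HrR HR Hc Hu Hl Hh E).
  fold K Q in D.
  specialize (D ltac:(nra) (S n) ltac:(lia)).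
  assert (HT : Series (tail R c n) <= B).
  { apply Series_le; [apply tail_pos | apply ex_sqn with R0; auto; lra]. }
  assert (HKN2 : K ^ length l <= (/ 1024) ^ n).
  { eapply Rle_trans; [exact HKN|]. apply pow_incr. split.
    - left. apply Rinv_0_lt_compat. lra.
    - apply Rinv_le_contravar; lra. }
  assert (D2 : sqterm r c (S n) <= 2 * (/ 1024) ^ n * B).
  { eapply Rle_trans; [exact D|].
    assert (0 < K ^ length l) by (apply pow_lt; lra).
    apply Rle_trans with (2 * K ^ length l * B); [apply Rmult_le_compat_l; lra|].
    apply Rmult_le_compat_r; lra. }
  assert (D3 : (Cmod (c (S n)) * (32 * r) ^ S n) ^ 2 <= 2048 * B).
  { replace ((Cmod (c (S n)) * (32 * r) ^ S n) ^ 2) with (1024 ^ S n * sqterm r c (S n)).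
    - apply Rle_trans with (1024 ^ S n * (2 * (/ 1024) ^ n * B)).
      + apply Rmult_le_compat_l; auto. apply pow_le; lra.
      + right. simpl. rewrite pow_inv. field. apply pow_nonzero. lra.
    - unfold sqterm. replace 1024 with (32 ^ 2) by ring.
      rewrite <- pow_mult, Nat.mul_comm, pow_mult, <- Rpow_mult_distr. f_equal.
      rewrite (Rpow_mult_distr 32 r). ring. }
  set (x := Cmod (c (S n)) * (32 * r) ^ S n) in *. assert (H := pow2_ge_0 (x - 1)). nra.
Qed.

Lemma finite_argmax (b : nat -> R) n0 K : exists j, (n0 < j)%nat /\
  forall k, (n0 < k)%nat -> (k <= S n0 + K)%nat -> b k <= b j.
Proof.
  induction K as [|K [j [Hj H]]].
  - exists (S n0). split; [lia|]. intros k H1 H2. replace k with (S n0) by lia. lra.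
  - destruct (Rle_lt_dec (b (S n0 + S K)%nat) (b j)) as [Hle|Hlt].
    + exists j. split; auto. intros k H1 H2.
      destruct (Nat.eq_dec k (S n0 + S K)) as [->|]; auto. apply H; lia.
    + exists (S n0 + S K)%nat. split; [lia|]. intros k H1 H2.
      destruct (Nat.eq_dec k (S n0 + S K)) as [->|]; [lra|].
      apply Rle_trans with (b j); [apply H; lia | lra].
Qed.

(** The geometric bound puts all but finitely many terms below the positive value [b k0], so the
    supremum is a maximum over a finite range. *)
Lemma tail_argmax (b : nat -> R) M n0 k0 : (forall k, 0 <= b k <= M * (/ 2) ^ k) ->
  (n0 < k0)%nat -> 0 < b k0 ->
  exists j, (n0 < j)%nat /\ 0 < b j /\ forall k, (n0 < k)%nat -> b k <= b j.
Proof.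
  intros Hb Hk0 Hpos.
  assert (HM : 0 <= M) by (specialize (Hb 0%nat); simpl in Hb; lra).
  destruct (pow_lt_1_zero (/ 2)) with (y := b k0 / (M + 1)) as [K HK].
  { rewrite Rabs_pos_eq; lra. }
  { apply Rdiv_lt_0_compat; lra. }
  destruct (finite_argmax b n0 (K + k0)) as [j [Hj H]].
  assert (Hk0j : b k0 <= b j) by (apply H; lia).
  exists j. split; auto. split; [lra|].
  intros k Hk. destruct (le_lt_dec k (S n0 + (K + k0))) as [Hle|Hlt]; [now apply H|].
  specialize (HK k ltac:(lia)). rewrite Rabs_pos_eq in HK by (apply pow_le; lra).
  apply Rlt_div_r in HK; [|lra]. specialize (Hb k).
  assert (0 < (/ 2) ^ k) by (apply pow_lt; lra). nra.
Qed.

Lemma coefficients_vanish c r n0 : 0 < r -> bnd (32 * r) c -> many_zeros c r 8 n0 ->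
  exists n, forall k, (n < k)%nat -> c k = 0%C.
Proof.
  intros Hr Hc Hz. apply NNPP. intros Hnot.
  (* Searching beyond [n0 + 1] ensures [n >= 1] for the maximal index [n + 1]; the final
     contradiction fails for [n = 0]. *)
  assert (Hex : exists k0, (S n0 < k0)%nat /\ c k0 <> 0%C).
  { apply NNPP. intros H. apply Hnot. exists (S n0). intros k Hk.
    apply NNPP. intros H'. apply H. now exists k. }
  destruct Hex as [k0 [Hk0 Hck0]].
  destruct Hc as [M HM].
  destruct (tail_argmax (fun k => Cmod (c k) * (16 * r) ^ k) M (S n0) k0) as [j [Hj [Hjpos Hmax]]]; auto.
  { intros k. split.
    - apply Rmult_le_pos; [apply Cmod_ge_0 | apply pow_le; lra].
    - specialize (HM k). replace (16 * r) with (32 * r * / 2) by field.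
      rewrite Rpow_mult_distr, <- Rmult_assoc. apply Rmult_le_compat_r; auto.
      apply pow_le; lra. }
  { apply Rmult_lt_0_compat; [now apply Cmod_gt_0 | apply pow_lt; lra]. }
  assert (Hc : bnd (32 * r) c) by now exists M.
  destruct j as [|n]; [lia|].
  destruct (Hz (32 * r) n ltac:(lra) Hc ltac:(lia) ltac:(lia)) as [u [l [h [Hu [Hl [Hh [E HN]]]]]]].
  (* The exact value is [4 * 64 / 65^2 = 256 / 4225], just below [1 / 16]. *)
  assert (HK : kappa r (8 * r) <= / 16).
  { unfold kappa. replace (4 * (8 * r) ^ 2 * r ^ 2 / ((8 * r) ^ 2 + r ^ 2) ^ 2) with (256 / 4225).
    - lra.
    - field. assert (0 < r * r) by nra. repeat split; intros ?; nra. }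
  assert (HK0 := kappa_pos r (8 * r) Hr ltac:(lra)).
  set (K := kappa r (8 * r)) in *.
  assert (HKN : K ^ length l <= (/ 16 ^ 8) ^ n).
  { apply Rle_trans with (K ^ (8 * n)); [apply pow_le_pow_lt1; auto; lra|].
    rewrite pow_mult, <- pow_inv. apply pow_incr. split; [apply pow_le; lra|].
    apply pow_incr; lra. }
  assert (D := coefficient_decay (32 * r) (8 * r) r c u n l h Hr ltac:(lra) ltac:(lra) Hc Hu Hl Hh E).
  fold K in D. replace (8 * r / r) with 8 in D by (field; lra).
  assert (Hpre : K ^ length l * (8 ^ 2) ^ n <= / 2).
  { apply Rle_trans with ((/ 16 ^ 8) ^ n * (8 ^ 2) ^ n).
    - apply Rmult_le_compat_r; auto. apply pow_le; lra.
    - rewrite <- Rpow_mult_distr. apply Rle_trans with ((/ 2) ^ n).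
      + apply pow_incr. lra.
      + rewrite <- (pow_1 (/2)) at 2. apply pow_le_pow_lt1; [lra|lia]. }
  specialize (D Hpre (S n) ltac:(lia)).
  set (A := Cmod (c (S n)) * (16 * r) ^ S n) in *.
  (* Above [n] maximality gives [|c_k| (16r)^k <= A], and passing to radius [8r] contributes
     [4^(-k)] after squaring. Bounding by the full geometric series from index 0 is enough. *)
  assert (HT : Series (tail (8 * r) c n) <= A ^ 2 / (1 - / 4)).
  { rewrite <- Series_geom_scal by lra. apply Series_le; [|apply ex_series_geom_scal; lra].
    intros k. split; [apply tail_pos|]. unfold tail.
    destruct (le_lt_dec k n).
    - apply Rmult_le_pos; [apply pow2_ge_0 | apply pow_le; lra].
    - unfold sqterm.
      replace (Cmod (c k) * (8 * r) ^ k) with ((Cmod (c k) * (16 * r) ^ k) * (/ 2) ^ k).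
      + rewrite Rpow_mult_distr. rewrite <- (pow_mult (/ 2)), Nat.mul_comm, (pow_mult (/ 2)).
        replace ((/ 2) ^ 2) with (/ 4) by field.
        apply Rmult_le_compat_r; [apply pow_le; lra|].
        apply pow_incr. split.
        * apply Rmult_le_pos; [apply Cmod_ge_0 | apply pow_le; lra].
        * destruct (Nat.eq_dec k (S n)) as [->|]; [apply Rle_refl|]. apply Hmax. lia.
      + rewrite Rmult_assoc, <- Rpow_mult_distr. do 2 f_equal. field. }
  assert (HS : sqterm r c (S n) = A ^ 2 * (/ 256) ^ S n).
  { unfold A, sqterm. rewrite (Rpow_mult_distr 16 r).
    replace (/ 256) with ((/ 16) ^ 2) by field.
    rewrite <- (pow_mult (/ 16)), Nat.mul_comm, (pow_mult (/ 16)), <- Rpow_mult_distr.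
    f_equal. rewrite pow_inv. field. apply pow_nonzero. lra. }
  rewrite HS in D.
  assert (HA : 0 < A ^ 2) by now apply pow_lt.
  assert (HKN0 : 0 < K ^ length l) by (apply pow_lt; lra).
  (* The constant is [2 * 4/3 < 3]. After cancelling [A^2] and [256^(-n)], using
     [16^8 = 256 * 16^6], there remains [1/256 <= 3 * 16^(-6n)], absurd for [n >= 1]. *)
  assert (D2 : A ^ 2 * (/ 256) ^ S n <= A ^ 2 * (3 * (/ 16 ^ 8) ^ n)) by nra.
  apply Rmult_le_reg_l in D2; auto.
  assert (D3 : (/ 16 ^ 8) ^ n = (/ 256) ^ n * (/ 16 ^ 6) ^ n).
  { rewrite <- Rpow_mult_distr. f_equal. field. }
  rewrite D3 in D2. simpl (/ 256 ^ S n) in D2.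
  assert (P1 : 0 < (/ 256) ^ n) by (apply pow_lt; lra).
  assert (P2 : (/ 16 ^ 6) ^ n <= / 16 ^ 6).
  { rewrite <- (pow_1 (/ 16 ^ 6)) at 2. apply pow_le_pow_lt1; [lra|lia]. }
  change ((/ 256) ^ S n) with (/ 256 * (/ 256) ^ n) in D2.
  set (P := (/ 256) ^ n) in *. set (Z := (/ 16 ^ 6) ^ n) in *.
  assert (Z <= / 16777216) by lra.
  nra.
Qed.

(** * Translating polynomials and zero counts into power series *)

Definition pcoef (l : list C) (k : nat) : C := nth k l 0%C.

Lemma bnd_pcoef R l : 0 < R -> bnd R (pcoef l).
Proof.
  intros HR. induction l as [|x l [M HM]].
  - exists 0. intros k. unfold pcoef. destruct k; simpl; rewrite Cmod_0; lra.
  - exists (Rmax (Cmod x) (M * R)). intros [|k].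
    + simpl. rewrite Rmult_1_r. apply Rmax_l.
    + eapply Rle_trans; [|apply Rmax_r]. specialize (HM k). unfold pcoef in *. simpl.
      rewrite (Rmult_comm R), <- Rmult_assoc. apply Rmult_le_compat_r; lra.
Qed.

Lemma Cpoly_eval_ev l z : Cpoly_eval l z = ev (pcoef l) z.
Proof.
  set (R := Cmod z + 1). assert (H0 := Cmod_ge_0 z).
  assert (HR : 0 < R) by (unfold R; lra). assert (Hz : Cmod z < R) by (unfold R; lra).
  induction l as [|x l IH]; rewrite (ev_incr_1 R); auto using bnd_pcoef.
  - rewrite (ev_ext (fun k => pcoef nil (S k)) (fun k => 0 * pcoef nil k)%C).
    + rewrite (ev_scal R); auto using bnd_pcoef. unfold pcoef. simpl. ring.
    + intros k. unfold pcoef. destruct k; simpl; ring.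
  - simpl. rewrite IH. reflexivity.
Qed.

(** The supremum need not be attained, nor be finite; but if no count exceeded [M n], then [M n]
    would be an upper bound for all of them, which excludes an infinite [NK] as well. *)
Lemma NK_zeros f r n (M : R) : (0 < n)%nat ->
  Rbar_lt (Finite M) (Rbar_div (NK f r n) (Finite (INR n))) ->
  exists p N, in_Pn n p /\
    has_zeros_ge unit_disk (closed_disk r) (fun z => Cminus (f z) (p z)) N /\ M * INR n < INR N.
Proof.
  intros Hn H. apply NNPP. intros Hnot.
  assert (HnR : 0 < INR n) by now apply lt_0_INR.
  assert (Hle : Rbar_le (NK f r n) (Finite (M * INR n))).
  { apply (proj2 (Lub_Rbar_correct _)). intros x [p [N [Hp [Hz ->]]]].
    simpl. apply Rnot_lt_le. intros Hlt. apply Hnot. now exists p, N. }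
  assert (Hinv : 0 < / INR n) by now apply Rinv_0_lt_compat.
  destruct (NK f r n) as [x| |]; simpl in Hle.
  - simpl in H. apply (Rlt_div_r M x (INR n)) in H; auto. lra.
  - contradiction.
  - unfold Rbar_div, Rbar_mult in H. simpl in H.
    destruct (Rle_dec 0 (/ INR n)) as [Hi|Hi]; [|lra].
    destruct (Rle_lt_or_eq_dec 0 (/ INR n) Hi); [exact H | lra].
Qed.

(** The zeros lie in [|z| <= r < 1], where [f - p] and its series agree. Their vanishing conditions
    concern coefficients only, so the factorization is valid at any radius [R0] where [c] is
    bounded, even beyond 1. *)
Lemma many_zeros_of_NK f c r m n0 : 0 < r -> r < 1 ->
  (forall R, 0 < R -> R < 1 -> bnd R c) -> (forall z, unit_disk z -> f z = ev c z) ->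
  (forall n, (n0 <= n)%nat -> (0 < n)%nat ->
     Rbar_lt (Finite (INR m)) (Rbar_div (NK f r n) (Finite (INR n)))) ->
  many_zeros c r m n0.
Proof.
  intros Hr Hr1 Hc Hf HN R0 n HR0 HcR Hn0 Hn.
  destruct (NK_zeros f r n (INR m) Hn (HN n Hn0 Hn)) as [p [N [[l [Hl Hp]] [[zs [Hnd [Hzs HNz]]] HmN]]]].
  set (g := (fun k => c k - pcoef l k)%C).
  assert (Hg : forall R, 0 < R -> bnd R c -> bnd R g).
  { intros R HR HcR'. apply bnd_ext with (fun k => c k + (-(1)) * pcoef l k)%C.
    - intros k. unfold g. ring.
    - apply bnd_plus; auto. apply bnd_scal. now apply bnd_pcoef. }
  destruct (zeros_factor R0 r zs HR0 Hnd g (Hg R0 ltac:(lra) HcR)) as [pts [h [H1 [H2 [H3 H4]]]]].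
  { intros am Ham. destruct (Hzs am Ham) as [Ha Hza]. split; [exact Ha|].
    unfold closed_disk in Ha.
    apply zero_order_ge_zero_dn with (f := fun z => (f z - p z)%C); auto.
    - intros z Hz. rewrite Hp, Cpoly_eval_ev, Hf by auto. unfold unit_disk in Hz.
      assert (H0 := Cmod_ge_0 z). set (R := (Cmod z + 1) / 2).
      assert (HR : 0 < R) by (unfold R; lra). assert (HzR : Cmod z < R) by (unfold R; lra).
      rewrite (ev_ext g (fun k => c k + (-(1)) * pcoef l k)%C) by (intros; unfold g; ring).
      rewrite (ev_plus R), (ev_scal R); auto using bnd_pcoef, bnd_scal.
      + ring.
      + apply Hc; unfold R; lra.
    - unfold unit_disk. lra. }
  exists (pcoef l), pts, h. split; [|split; [|split; [|split]]]; auto.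
  - intros k Hk. unfold pcoef. apply nth_overflow. lia.
  - rewrite H1. rewrite <- mult_INR in HmN. apply INR_lt in HmN. lia.
Qed.

Lemma eventually_zero_polynomial f c n : (forall z, unit_disk z -> f z = ev c z) ->
  (forall k, (n < k)%nat -> c k = 0%C) ->
  exists p, in_Pn n p /\ forall z, unit_disk z -> f z = p z.
Proof.
  intros Hf Hc. exists (Cpoly_eval (map c (seq 0 (S n)))). split.
  - exists (map c (seq 0 (S n))). split; auto. now rewrite length_map, length_seq.
  - intros z Hz. rewrite Hf, Cpoly_eval_ev by auto. apply ev_ext. intros k.
    unfold pcoef. destruct (le_lt_dec k n) as [Hk|Hk].
    + rewrite nth_indep with (d' := c 0%nat) by (rewrite length_map, length_seq; lia).
      rewrite map_nth, seq_nth by lia. reflexivity.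
    + rewrite Hc by auto. rewrite nth_overflow; auto. rewrite length_map, length_seq. lia.
Qed.

Theorem theorem1p1 (f : C -> C) (r : R) :
  holomorphic_on unit_disk f ->
  0 < r -> r < 1 ->
  (forall M : R, exists n0 : nat, forall n : nat, (n0 <= n)%nat -> (0 < n)%nat ->
     Rbar_lt (Finite M) (Rbar_div (NK f r n) (Finite (INR n)))) ->
  exists (n : nat) (p : C -> C), in_Pn n p /\ forall z, unit_disk z -> f z = p z.
Proof.
  intros Hf Hr Hr1 HN.
  destruct (holomorphic_power_series f Hf) as [c [Hc Hev]].
  assert (Hz : forall m, exists n0, many_zeros c r m n0).
  { intros m. destruct (HN (INR m)) as [n0 Hn0]. exists n0.
    now apply many_zeros_of_NK with f. }
  assert (Hc32 : bnd (32 * r) c).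
  { apply radius_enlarged with ((r + 1) / 2); auto; try lra. apply Hc; lra. }
  destruct (Hz 8%nat) as [n0 Hn0].
  destruct (coefficients_vanish c r n0 Hr Hc32 Hn0) as [n Hn].
  exists n. now apply eventually_zero_polynomial with c.
Qed.
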